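(* Let $S\ge2$, $L$, $m$, $n_B$ be positive integers, let $P_1,\dots,P_S$ be types of sequences in $\mathcal X^m$, let $\epsilon\in(0,1)$, $\tau\in(0,\epsilon)$, $\zeta>0$, and let $h_\ell:\mathcal X^{(\ell-1)m}\times\mathcal Y^{(\ell-1)m}\times\mathcal Y^{(\ell-1)m}\to\{1,\dots,S\}$, $\ell=1,\dots,L$, be arbitrary mappings. Let $\mathbb x$ be any element of $$\mathbb F=\{\mathbb x\in\mathcal X^{SLm}:\ \mathbb x_\ell(s)\text{ has type }P_s\ \ \forall s\in\{1,\dots,S\},\ \forall \ell\in\{1,\dots,L\}\}.$$ Then $$\log M^*_{\mathrm f}\big(Lm+n_B,\ \epsilon+\epsilon^*(n_B,S^L)\big)\ \ge\ \sup\Big\{\gamma:\ \max_{k}\mathbb P\big[\imath_k(\mathbb x^L(B^L);\mathbb Y_k^L(B^L))\le\gamma\big]<\epsilon-\tau-e^{-\zeta}\Big\}+\log\frac\tau2-SL|\mathcal X|\log(1+m)-L\log S-\zeta,$$ where the probability is under the distribution $\mathbb P_{\mathbb Y_1,\mathbb Y_2,B^L}$ defined below.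
   Context: Setting (CM-DMBC): finite alphabets $\mathcal X=\{1,\dots,N\}$, $\mathcal Y$; transition matrices $W_1,W_2$; given input $x$ the two outputs are $(y_1,y_2)$ with probability $W_1(y_1|x)W_2(y_2|x)$, memoryless. $\imath_{P,W_k}(x;y)=\log\frac{W_k(y|x)}{PW_k(y)}$ with $PW_k(y)=\sum_xP(x)W_k(y|x)$. An $(n,M,\epsilon)$-FLF code: encoders $f_i:\{1,\dots,M\}\times\mathcal Y^{i-1}\times\mathcal Y^{i-1}\to\mathcal X$ (possibly randomized), $X_i=f_i(J,Y_1^{i-1},Y_2^{i-1})$ with $J$ uniform on $\{1,\dots,M\}$; decoders $g_k:\mathcal Y^n\to\{1,\dots,M\}$ with $\mathbb P[g_k(Y_k^n)\ne J]\le\epsilon$, $k=1,2$. $M^*_{\mathrm f}(n,\epsilon)$ is the largest $M$ for which an $(n,M,\epsilon)$-FLF code exists. $\epsilon^*(n_B,S^L)$ is the smallest $\epsilon$ such that there exists a fixed-length no-feedback code for the CM-DMBC of blocklength $n_B$ with $S^L$ messages (encoder a map from messages to $\mathcal X^{n_B}$, decoders $g_k:\mathcal Y^{n_B}\to$ messages) with $\mathbb P[g_k(Y_k^{n_B})\ne J]\le\epsilon$ for $k=1,2$. Indexing: elements $\mathbb x\in\mathcal X^{SLm}$ are written $\mathbb x=(\mathbb x_1(1),\dots,\mathbb x_1(S),\dots,\mathbb x_L(1),\dots,\mathbb x_L(S))$ with $\mathbb x_\ell(s)=(\mathbb x_{\ell,1}(s),\dots,\mathbb x_{\ell,m}(s))\in\mathcal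 X^m$; for $b^\ell\in\{1,\dots,S\}^\ell$, $\mathbb x^\ell(b^\ell)=(\mathbb x_1(b_1),\dots,\mathbb x_\ell(b_\ell))$; the same indexing is used for elements $\mathbb y_k\in\mathcal Y^{SLm}$. The distribution of $(\mathbb Y_1,\mathbb Y_2,B^L)\in\mathcal Y^{SLm}\times\mathcal Y^{SLm}\times\{1,\dots,S\}^L$ is $$\mathbb P_{\mathbb Y_1,\mathbb Y_2,B^L}(\mathbb y_1,\mathbb y_2,b^L)=\prod_{\ell=1}^L\Big(\prod_{s=1}^S\prod_{k=1}^2W_k^m(\mathbb y_{k,\ell}(s)|\mathbb x_\ell(s))\Big)\mathbb 1\{h_\ell(\mathbb x^{\ell-1}(b^{\ell-1}),\mathbb y_1^{\ell-1}(b^{\ell-1}),\mathbb y_2^{\ell-1}(b^{\ell-1}))=b_\ell\},$$ where $W_k^m$ is the product channel. Finally $\imath_k(\mathbb x_\ell(b_\ell);\mathbb y_{k,\ell}(b_\ell))=\sum_{i=1}^m\imath_{P_{b_\ell},W_k}(\mathbb x_{\ell,i}(b_\ell);\mathbb y_{k,\ell,i}(b_\ell))$ and $\imath_k(\mathbb x^L(b^L);\mathbb y_k^L(b^L))=\sum_{\ell=1}^L\imath_k(\mathbb x_\ell(b_\ell);\mathbb y_{k,\ell}(b_\ell))$. Logarithms are natural. *)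

(* Defs.v *)
From HB Require Import structures.
From mathcomp Require Import all_boot.
From Stdlib Require Import Reals.
Set Implicit Arguments. Unset Strict Implicit. Unset Printing Implicit Defensive.

Lemma Rplus_assoc' : associative Rplus.
Proof. by move=> a b c; rewrite Rplus_assoc. Qed.
Lemma Rmult_assoc' : associative Rmult.
Proof. by move=> a b c; rewrite Rmult_assoc. Qed.
HB.instance Definition _ :=
  Monoid.isComLaw.Build R 0%R Rplus Rplus_assoc' Rplus_comm Rplus_0_l.
HB.instance Definition _ :=
  Monoid.isComLaw.Build R 1%R Rmult Rmult_assoc' Rmult_comm Rmult_1_l.

Notation "\rsum_ ( i : T ) F" := (\big[Rplus/0%R]_(i : T) F%R)
  (at level 41, F at level 41, i, T at level 50).
Notation "\rprod_ ( i : T ) F" := (\big[Rmult/1%R]_(i : T) F%R)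
  (at level 36, F at level 36, i, T at level 50).

Section Defs.
Variables (X Y : finType).

Definition stochastic (W : X -> Y -> R) : Prop :=
  (forall x y, 0 <= W x y)%R /\ forall x, \rsum_(y : Y) W x y = 1%R.

Definition output_dist (P : X -> R) (W : X -> Y -> R) (y : Y) : R :=
  \rsum_(x : X) (P x * W x y).

Definition info_dens (P : X -> R) (W : X -> Y -> R) (x : X) (y : Y) : R :=
  ln (W x y / output_dist P W y).

Definition type_of (m : nat) (v : {ffun 'I_m -> X}) (a : X) : R :=
  (INR #|[set i | v i == a]| / INR m)%R.

Definition is_type (m : nat) (P : X -> R) : Prop :=
  exists v : {ffun 'I_m -> X}, forall a, type_of v a = P a.

Definition Wn (n : nat) (W : X -> Y -> R) (xv : {ffun 'I_n -> X})
  (yv : {ffun 'I_n -> Y}) : R := \rprod_(i : 'I_n) W (xv i) (yv i).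

Definition sel2 (A : Type) (k : 'I_2) (a b : A) : A :=
  if k == ord0 then a else b.

Definition prefix (n : nat) (i : 'I_n) (A : Type) (y : 'I_n -> A) : {ffun 'I_i -> A} :=
  [ffun t : 'I_i => y (widen_ord (ltnW (ltn_ord i)) t)].

(* A (possibly randomized) encoder: common randomness u drawn from pU on a
   finite set U; X_i = enc i u J Y_1^{i-1} Y_2^{i-1} (times are 0-based). *)
Definition FLF_enc (n M : nat) (U : finType) :=
  forall i : 'I_n, U -> 'I_M -> {ffun 'I_i -> Y} -> {ffun 'I_i -> Y} -> X.

Definition FLF_error (W1 W2 : X -> Y -> R) (n M : nat) (U : finType)
  (pU : U -> R) (enc : FLF_enc n M U) (dec : {ffun 'I_n -> Y} -> 'I_M)
  (k : 'I_2) : R :=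
  \rsum_(u : U) \rsum_(j : 'I_M) \rsum_(y1 : {ffun 'I_n -> Y})
    \rsum_(y2 : {ffun 'I_n -> Y})
     (pU u * / INR M *
      (\rprod_(i : 'I_n)
         (W1 (enc i u j (prefix i y1) (prefix i y2)) (y1 i) *
          W2 (enc i u j (prefix i y1) (prefix i y2)) (y2 i))) *
      (if dec (sel2 k y1 y2) == j then 0 else 1))%R.

Definition is_distribution (U : finType) (pU : U -> R) : Prop :=
  (forall u, 0 <= pU u)%R /\ \rsum_(u : U) pU u = 1%R.

Definition FLF_code_exists (W1 W2 : X -> Y -> R) (n M : nat) (eps : R) : Prop :=
  (0 < M)%N /\
  exists (U : finType) (pU : U -> R) (enc : FLF_enc n M U)
         (g1 g2 : {ffun 'I_n -> Y} -> 'I_M),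
    is_distribution pU /\
    (FLF_error W1 W2 pU enc g1 ord0 <= eps)%R /\
    (FLF_error W1 W2 pU enc g2 (lift ord0 ord0) <= eps)%R.

(* log M*_f(n, eps) >= r  (M*_f = largest M with an (n,M,eps)-FLF code) *)
Definition log_Mstar_ge (W1 W2 : X -> Y -> R) (n : nat) (eps r : R) : Prop :=
  exists M : nat, FLF_code_exists W1 W2 n M eps /\ (r <= ln (INR M))%R.

Definition FL_error (W : X -> Y -> R) (nB K : nat) (enc : 'I_K -> {ffun 'I_nB -> X})
  (dec : {ffun 'I_nB -> Y} -> 'I_K) : R :=
  \rsum_(j : 'I_K) \rsum_(y : {ffun 'I_nB -> Y})
    (/ INR K * Wn W (enc j) y * (if dec y == j then 0 else 1))%R.

Definition FL_achievable (W1 W2 : X -> Y -> R) (nB K : nat) (e : R) : Prop :=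
  exists (enc : 'I_K -> {ffun 'I_nB -> X}) (g1 g2 : {ffun 'I_nB -> Y} -> 'I_K),
    (FL_error W1 enc g1 <= e)%R /\ (FL_error W2 enc g2 <= e)%R.

Definition is_epsstar (W1 W2 : X -> Y -> R) (nB K : nat) (e : R) : Prop :=
  FL_achievable W1 W2 nB K e /\
  forall e', FL_achievable W1 W2 nB K e' -> (e <= e')%R.

Variables (S L m : nat).

(* xx l s = x_l(s) in X^m  (l, s 0-based);  yy l s = y_l(s) *)
Definition codearr := 'I_L -> 'I_S -> {ffun 'I_m -> X}.
Definition outarr := {ffun 'I_L -> {ffun 'I_S -> {ffun 'I_m -> Y}}}.
Definition selarr := {ffun 'I_L -> 'I_S}.

(* h l : X^{lm} x Y^{lm} x Y^{lm} -> {1..S}  (block l, 0-based, sees l past blocks) *)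
Definition selector :=
  forall l : 'I_L, {ffun 'I_l -> {ffun 'I_m -> X}} ->
    {ffun 'I_l -> {ffun 'I_m -> Y}} -> {ffun 'I_l -> {ffun 'I_m -> Y}} -> 'I_S.

Definition in_F (P : 'I_S -> X -> R) (xx : codearr) : Prop :=
  forall l s a, type_of (xx l s) a = P s a.

Definition xpre (xx : codearr) (b : selarr) (l : 'I_L) :=
  prefix l (fun t : 'I_L => xx t (b t)).
Definition ypre (yy : outarr) (b : selarr) (l : 'I_L) :=
  prefix l (fun t : 'I_L => yy t (b t)).

Definition joint (W1 W2 : X -> Y -> R) (h : selector) (xx : codearr)
  (y1 y2 : outarr) (b : selarr) : R :=
  \rprod_(l : 'I_L)
    ((\rprod_(s : 'I_S) (Wn W1 (xx l s) (y1 l s) * Wn W2 (xx l s) (y2 l s))) *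
     (if h l (xpre xx b l) (ypre y1 b l) (ypre y2 b l) == b l then 1 else 0)).

Definition info_L (P : 'I_S -> X -> R) (W : X -> Y -> R) (xx : codearr)
  (yy : outarr) (b : selarr) : R :=
  \rsum_(l : 'I_L) \rsum_(i : 'I_m) info_dens (P (b l)) W (xx l (b l) i) (yy l (b l) i).

Definition prob_info_le (W1 W2 : X -> Y -> R) (P : 'I_S -> X -> R) (h : selector)
  (xx : codearr) (k : 'I_2) (gamma : R) : R :=
  \rsum_(y1 : outarr) \rsum_(y2 : outarr) \rsum_(b : selarr)
    (joint W1 W2 h xx y1 y2 b *
     (if Rle_dec (info_L P (sel2 k W1 W2) xx (sel2 k y1 y2) b) gamma then 1 else 0)).

End Defs.

(* Main.v *)
(**
  Each message owns an interleaver, a permutation of the [m] positions of each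
  of the [L] blocks, and a relabelling of the [S^L] selection sequences.  The
  encoder runs the scheme [(xx, h)] on deinterleaved outputs and then sends the
  relabelled selections with the given fixed-length code; receiver [k] returns
  the last message whose deinterleaved outputs pass a likelihood-ratio test at
  the selections it decoded.

  Deinterleaving makes the law of the scheme the same for all messages.  Every
  label is used equally often, so the fixed-length code sees uniform messages
  and contributes exactly its average error, for both receivers at once.  The
  confusion probability is handled by choosing interleavers greedily: averaged
  over a uniform interleaver, the likelihood of fixed outputs is within a
  polynomial factor of the i.i.d. one (method of types, with the crude factorial
  bounds [(n/e)^n <= n! <= (n+1)^2 (n/e)^n]; the resulting factor
  [(1+m)^(2 L |X|)] is affordable because [2 <= S]).
*)
Require Import Defs.
From HB Require Import structures.
From mathcomp Require Import all_boot all_fingroup.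
From Stdlib Require Import Reals Lra.
Set Implicit Arguments. Unset Strict Implicit. Unset Printing Implicit Defensive.

(** * Finite sums and products of real numbers *)

HB.instance Definition _ :=
  Monoid.isMulLaw.Build R 0%R Rmult Rmult_0_l Rmult_0_r.
HB.instance Definition _ :=
  Monoid.isAddLaw.Build R Rmult Rplus Rmult_plus_distr_r Rmult_plus_distr_l.

Section RealBigops.
Local Open Scope R_scope.

Lemma rsum_ge0 (I : Type) (r : seq I) (P : pred I) (F : I -> R) :
  (forall i, P i -> 0 <= F i) -> 0 <= \big[Rplus/0]_(i <- r | P i) F i.
Proof. by move=> F0; elim/big_ind: _ => [|a b|//]; lra. Qed.

Lemma rprod_ge0 (I : Type) (r : seq I) (P : pred I) (F : I -> R) :
  (forall i, P i -> 0 <= F i) -> 0 <= \big[Rmult/1]_(i <- r | P i) F i.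
Proof.
by move=> F0; elim/big_ind: _ => [|a b|//]; [lra | apply: Rmult_le_pos].
Qed.

Lemma rprod_gt0 (I : Type) (r : seq I) (P : pred I) (F : I -> R) :
  (forall i, P i -> 0 < F i) -> 0 < \big[Rmult/1]_(i <- r | P i) F i.
Proof.
by move=> F0; elim/big_ind: _ => [|a b|//]; [lra | apply: Rmult_lt_0_compat].
Qed.

Lemma ler_rsum (I : Type) (r : seq I) (P : pred I) (F G : I -> R) :
  (forall i, P i -> F i <= G i) ->
  \big[Rplus/0]_(i <- r | P i) F i <= \big[Rplus/0]_(i <- r | P i) G i.
Proof. by move=> FG; elim/big_ind2: _ => [|a b c d|//]; lra. Qed.

Lemma ler_rprod (I : Type) (r : seq I) (P : pred I) (F G : I -> R) :
  (forall i, P i -> 0 <= F i <= G i) ->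
  \big[Rmult/1]_(i <- r | P i) F i <= \big[Rmult/1]_(i <- r | P i) G i.
Proof.
move=> FG; suff [] : 0 <= \big[Rmult/1]_(i <- r | P i) F i <=
  \big[Rmult/1]_(i <- r | P i) G i by [].
elim/big_ind2: _ => [|a b c d [a0 ab] [c0 cd]|//]; first by lra.
by split; [apply: Rmult_le_pos | apply: Rmult_le_compat].
Qed.

Lemma rsum_const (T : finType) (c : R) : \rsum_(i : T) c = INR #|T| * c.
Proof.
rewrite big_const; elim: #|T| => [|n IH]; first by rewrite /= Rmult_0_l.
by rewrite iterS IH S_INR; lra.
Qed.

Lemma rsum_ge_term (I : finType) (P : pred I) (F : I -> R) (i : I) :
  P i -> (forall i, P i -> 0 <= F i) -> F i <= \big[Rplus/0]_(i | P i) F i.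
Proof.
move=> Pi F0; rewrite (bigD1 i) //=.
have : 0 <= \big[Rplus/0]_(j | P j && (j != i)) F j.
  by apply: rsum_ge0 => j /andP[/F0].
by lra.
Qed.

(** First-moment argument: if every value exceeded [c], so would the average, strictly because [T]
    has an element. *)
Lemma rsum_exists_le (T : finType) (F : T -> R) (c : R) :
  (0 < #|T|)%nat -> \rsum_(t : T) F t <= INR #|T| * c -> exists t, F t <= c.
Proof.
move=> T0 Fc; case: (boolP [exists t, Rle_dec (F t) c : bool]).
  by move=> /existsP[t]; case: (Rle_dec (F t) c) => // ? _; exists t.
move=> /existsPn F_gt.
have {}F_gt t : c < F t.
  by move: (F_gt t); case: (Rle_dec (F t) c) => // cF _; apply: Rnot_le_lt.
case/card_gt0P: T0 => t0 _.
suff : \rsum_(t : T) c < \rsum_(t : T) F t by rewrite rsum_const; lra.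
rewrite (bigD1 t0) //= [X in _ < X](bigD1 t0) //=.
have := F_gt t0.
have : \big[Rplus/0]_(t | t != t0) c <= \big[Rplus/0]_(t | t != t0) F t.
  by apply: ler_rsum => t _; have := F_gt t; lra.
by lra.
Qed.

Lemma rprod_const (T : finType) (c : R) : \rprod_(i : T) c = c ^ #|T|.
Proof. by rewrite big_const; elim: #|T| => //= n ->. Qed.

Lemma rprod_neq0 (I : finType) (F : I -> R) i : \rprod_(i : I) F i <> 0 -> F i <> 0.
Proof. by move=> H Fi; apply: H; rewrite (bigD1 i) //= Fi Rmult_0_l. Qed.

Lemma INR_prodn (I : Type) (r : seq I) (F : I -> nat) :
  INR (\prod_(i <- r) F i)%nat = \big[Rmult/1]_(i <- r) INR (F i).
Proof.
by elim/big_rec2: _ => [//|i y x _ <-]; rewrite -mult_INR.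
Qed.

Lemma exp_rsum (I : Type) (r : seq I) (F : I -> R) :
  exp (\big[Rplus/0]_(i <- r) F i) = \big[Rmult/1]_(i <- r) exp (F i).
Proof.
elim/big_rec2: _ => [|i y x _ <-]; first by rewrite exp_0.
by rewrite exp_plus.
Qed.

Lemma rsum_indicator (T : finType) (t : T) (F : T -> R) :
  \rsum_(i : T) (F i * (if i == t then 1 else 0)) = F t.
Proof.
rewrite (bigD1 t) //= eqxx big1 => [|i /negbTE ->]; lra.
Qed.

Lemma rsum_ffun_prod (I J : finType) (F : I -> J -> R) :
  \rsum_(f : {ffun I -> J}) \rprod_(i : I) F i (f i) =
  \rprod_(i : I) \rsum_(j : J) F i j.
Proof. by rewrite bigA_distr_bigA. Qed.

End RealBigops.

(** * Elementary bounds of Stirling type *)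

Section FactorialBounds.
Local Open Scope R_scope.

Lemma pow_exp (n : nat) (a : R) : exp a ^ n = exp (INR n * a).
Proof.
elim: n => [|n IH]; first by rewrite Rmult_0_l exp_0.
by rewrite S_INR Rmult_plus_distr_r Rmult_1_l exp_plus -IH /=; lra.
Qed.

Lemma factS_R (n : nat) : INR (n.+1)`! = INR n.+1 * INR n`!.
Proof. by rewrite factS mult_INR. Qed.

(** This is [(1 + 1/n)^n <= e] cleared of denominators, the induction step of [fact_ge]. *)
Lemma succ_pow_le_exp (n : nat) : INR n.+1 ^ n <= exp 1 * INR n ^ n.
Proof.
case: n => [|n].
  by have := exp_ineq1_le 1 => /=; lra.
have n0 : 0 < INR n.+1 by apply: lt_0_INR; apply/ltP.
have -> : INR n.+2 = INR n.+1 * (1 + / INR n.+1).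
  by rewrite [INR n.+2]S_INR; field; lra.
rewrite Rpow_mult_distr Rmult_comm; apply: Rmult_le_compat_r.
  by apply: pow_le; lra.
have -> : exp 1 = exp (/ INR n.+1) ^ n.+1.
  by rewrite pow_exp; congr exp; field; lra.
apply: pow_incr; split; last exact: exp_ineq1_le.
by have := Rinv_0_lt_compat _ n0; lra.
Qed.

Lemma fact_ge (n : nat) : INR n ^ n * exp (- INR n) <= INR n`!.
Proof.
elim: n => [|n IH]; first by rewrite /= Ropp_0 exp_0; lra.
rewrite factS_R S_INR Ropp_plus_distr exp_plus -S_INR.
have -> : INR n.+1 ^ n.+1 = INR n.+1 * INR n.+1 ^ n by [].
rewrite !Rmult_assoc; apply: Rmult_le_compat_l; first exact: pos_INR.
apply: Rle_trans IH; have := succ_pow_le_exp n => H.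
have e0 := exp_pos (- INR n); have e1 := exp_pos (- (1)).
have ee : exp 1 * exp (- (1)) = 1 by rewrite -exp_plus Rplus_opp_r exp_0.
apply: Rle_trans (_ : (exp 1 * INR n ^ n) * (exp (- INR n) * exp (- (1))) <= _).
  by apply: Rmult_le_compat_r => //; apply: Rmult_le_pos; lra.
have -> : exp 1 * INR n ^ n * (exp (- INR n) * exp (- (1))) =
   (exp 1 * exp (- (1))) * (INR n ^ n * exp (- INR n)) by ring.
by rewrite ee; lra.
Qed.

(** This is [(1 - 1/(n+1))^(n+1) <= 1/e], from [1 + x <= exp x] at a negative [x]; it is the
    induction step of [fact_le]. *)
Lemma pow_exp_le_succ (n : nat) : exp 1 * INR n ^ n.+1 <= INR n.+1 ^ n.+1.
Proof.
case: n => [|n]; first by rewrite /=; lra.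
have n0 : 0 < INR n.+1 by apply: lt_0_INR; apply/ltP.
have n1 : 0 < INR n.+2 by apply: lt_0_INR; apply/ltP.
have -> : INR n.+1 = INR n.+2 * (1 + - / INR n.+2).
  by rewrite [INR n.+2]S_INR; field; rewrite S_INR in n1; lra.
set a := (1 + _).
rewrite Rpow_mult_distr.
have a0 : 0 <= a.
  have : / INR n.+2 <= 1.
    rewrite -Rinv_1; apply: Rinv_le_contravar; first lra.
    by rewrite S_INR; lra.
  by rewrite /a; lra.
have -> : exp 1 = exp (/ INR n.+2) ^ n.+2.
  by rewrite pow_exp; congr exp; field; lra.
have pa : exp (/ INR n.+2) ^ n.+2 * a ^ n.+2 <= 1.
  rewrite -Rpow_mult_distr -(pow1 n.+2); apply: pow_incr; split.
    by apply: Rmult_le_pos => //; apply/Rlt_le/exp_pos.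
  have : a <= exp (- / INR n.+2) by apply: exp_ineq1_le.
  move=> /(Rmult_le_compat_l _ _ _ (Rlt_le _ _ (exp_pos (/ INR n.+2)))).
  by rewrite -exp_plus Rplus_opp_r exp_0.
have p0 : 0 <= INR n.+2 ^ n.+2 by apply: pow_le; lra.
have := Rmult_le_compat_l _ _ _ p0 pa; lra.
Qed.

Lemma fact_le (n : nat) :
  INR n`! <= (1 + INR n) ^ 2 * (INR n ^ n * exp (- INR n)).
Proof.
case: n => [|n]; first by rewrite /= Ropp_0 exp_0; lra.
(* The induction runs on the sharper bound [n! <= e n (n/e)^n], valid for positive [n]; then
   [e n <= 3 n <= (1 + n)^2]. *)
suff : INR (n.+1)`! <= exp 1 * INR n.+1 * (INR n.+1 ^ n.+1 * exp (- INR n.+1)).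
  move=> /Rle_trans; apply; apply: Rmult_le_compat_r.
    apply: Rmult_le_pos; last exact/Rlt_le/exp_pos.
    by apply: pow_le; exact: pos_INR.
  have := exp_le_3; have := pos_INR n.+1; nra.
elim: n => [|n IH].
  have -> : INR 1 = 1 by [].
  by have := exp_Ropp 1; have := exp_pos 1 => e0 ->; rewrite /=; field_simplify; lra.
rewrite factS_R [X in exp (- X)]S_INR Ropp_plus_distr exp_plus.
have n0 : 0 <= INR n.+1 by exact: pos_INR.
have n1 : 0 <= INR n.+2 by exact: pos_INR.
apply: Rle_trans (Rmult_le_compat_l _ _ _ n1 IH) _.
have e1 := exp_pos 1; have e2 := exp_pos (- INR n.+1).
have ee : exp 1 * exp (- (1)) = 1 by rewrite -exp_plus Rplus_opp_r exp_0.
have -> : exp 1 * INR n.+2 * (INR n.+2 ^ n.+2 * (exp (- INR n.+1) * exp (- (1)))) =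
  (exp 1 * exp (- (1))) * (INR n.+2 * exp (- INR n.+1) * INR n.+2 ^ n.+2) by ring.
rewrite ee Rmult_1_l.
have -> : INR n.+2 * (exp 1 * INR n.+1 * (INR n.+1 ^ n.+1 * exp (- INR n.+1))) =
  INR n.+2 * exp (- INR n.+1) * (exp 1 * INR n.+1 ^ n.+2) by rewrite /=; ring.
apply: Rmult_le_compat_l; last exact: pow_exp_le_succ.
by apply: Rmult_le_pos => //; lra.
Qed.

End FactorialBounds.

(** * Permutations of the positions of a word, counted by level sets *)

Section PermutationCounting.
Variables (T X : finType) (x : T -> X).

Let level (a : X) : {set T} := [set i | x i == a].

(** A permutation preserving [x] maps each level set to itself and is determined by its restrictions
    to them; these range over the permutations supported in the level sets. *)
Lemma card_level_stabiliser :
  #|[set s : {perm T} | [forall i, x (s i) == x i]]| <=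
  \prod_(a : X) (#|level a|)`!.
Proof.
set A := [set s | _].
have AN s a : s \in A -> s \in ('N(level a | 'P))%g.
  rewrite inE => /forallP sx; rewrite 3!inE /=.
  by apply/subsetP => i; rewrite !inE /aperm (eqP (sx i)).
pose f (s : {perm T}) := [ffun a : X => restr_perm (level a) s].
have f_inj : {in A &, injective f}.
  move=> s t sA tA fst; apply/permP => i.
  have iL : i \in level (x i) by rewrite inE.
  rewrite -(restr_permE (AN s (x i) sA) iL) -(restr_permE (AN t (x i) tA) iL).
  by move/ffunP: fst => /(_ (x i)); rewrite !ffunE => ->.
rewrite -(card_in_imset f_inj).
have -> : \prod_(a : X) (#|level a|)`! = #|finfun.family (fun a => perm_on (level a))|.
  rewrite card_family foldrE big_map big_enum /=.
  by apply: eq_bigr => a _; rewrite card_perm.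
apply/subset_leq_card/subsetP => _ /imsetP[s _ ->].
by apply/familyP => a; rewrite ffunE; exact: restr_perm_on.
Qed.

(** Left multiplication by the inverse of one member [s0] embeds the fibre into the stabiliser of
    [x]. *)
Lemma card_level_fiber (v : {ffun T -> X}) :
  #|[set s : {perm T} | [ffun i => x (s i)] == v]| <=
  \prod_(a : X) (#|level a|)`!.
Proof.
set A := [set s | _].
have [->|[s0 s0A]] := set_0Vmem A; first by rewrite cards0.
apply: leq_trans card_level_stabiliser.
rewrite -(card_imset (mem A) (@mulgI _ (s0^-1)%g)).
apply/subset_leq_card/subsetP => _ /imsetP[s sA ->].
move: sA s0A; rewrite !inE => /eqP/ffunP sv /eqP/ffunP s0v.
apply/forallP => i; rewrite permM; apply/eqP.
have := sv (s0^-1 i)%g; rewrite -s0v !ffunE => ->.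
by rewrite permKV.
Qed.

Local Open Scope R_scope.

Lemma rsum_perm_le (f : {ffun T -> X} -> R) :
  (forall v, 0 <= f v) ->
  \rsum_(s : {perm T}) f [ffun i => x (s i)] <=
  INR (\prod_(a : X) (#|level a|)`!)%nat *
  \big[Rplus/0]_(v : {ffun T -> X} | [exists s : {perm T}, [ffun i => x (s i)] == v]) f v.
Proof.
move=> f0.
rewrite (partition_big (fun s : {perm T} => [ffun i => x (s i)])
  (fun v => [exists s : {perm T}, [ffun i => x (s i)] == v])) /=; last first.
  by move=> s _; apply/existsP; exists s.
rewrite big_distrr; apply: ler_rsum => v _.
rewrite (eq_bigr (fun=> f v)) => [|s /eqP -> //].
rewrite big_const.
have -> c n : iter n (Rplus c) 0 = INR n * c.
  by elim: n => [|n IH]; [rewrite /= Rmult_0_l | rewrite iterS IH S_INR; lra].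
apply: Rmult_le_compat_r => //; apply: le_INR; apply/leP.
apply: leq_trans (card_level_fiber v).
by apply: subset_leq_card; apply/subsetP => s; rewrite !inE.
Qed.

Lemma rprod_level (F : X -> R) :
  \rprod_(i : T) F (x i) = \rprod_(a : X) F a ^ #|level a|.
Proof.
rewrite (partition_big x predT) //=; apply: eq_bigr => a _.
rewrite (eq_bigr (fun=> F a)) => [|i /eqP -> //].
rewrite big_const (_ : #|_| = #|level a|); last first.
  by apply: eq_card => i; rewrite !inE.
by elim: #|level a| => //= n ->.
Qed.

Lemma rsum_card_level : \rsum_(a : X) INR #|level a| = INR #|T|.
Proof.
have -> : #|T| = (\sum_(a : X) #|level a|)%nat.
  rewrite -sum1_card (partition_big x predT) //=; apply: eq_bigr => a _.
  by rewrite -sum1_card; apply: eq_bigl => i; rewrite inE.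
by elim/big_rec2: _ => [//|a n r _ ->]; rewrite plus_INR.
Qed.

End PermutationCounting.

(** * Method of types: averages over rearrangements of a word *)

Section PermanentBound.
Local Open Scope R_scope.
Variables (X : finType) (m : nat) (x : {ffun 'I_m -> X}).
Hypothesis m_gt0 : (0 < m)%nat.

Let cnt a := #|[set i | x i == a]|.

Lemma type_of_gt0 i : 0 < type_of x (x i).
Proof.
apply: Rdiv_lt_0_compat; apply: lt_0_INR; apply/ltP => //.
by apply/card_gt0P; exists i; rewrite inE.
Qed.

Lemma type_of_ge0 a : 0 <= type_of x a.
Proof.
apply: Rmult_le_pos; first exact: pos_INR.
by apply/Rlt_le/Rinv_0_lt_compat/lt_0_INR/ltP.
Qed.

(** Equivalently, the i.i.d. law of the empirical distribution of [x] gives the type class of [x]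
    mass at least [(1 + m)^(-2|X|)]. Each [(cnt a)!] is bounded above by [fact_le] and [m!] below by
    [fact_ge]; the exponentials cancel because the counts sum to [m]. *)
Lemma prod_fact_type_le :
  INR (\prod_(a : X) (cnt a)`!)%nat <=
  INR m`! * (1 + INR m) ^ (2 * #|X|) * \rprod_(i : 'I_m) type_of x (x i).
Proof.
have m0 : 0 < INR m by apply: lt_0_INR; apply/ltP.
have mm0 : 0 < INR m ^ m by apply: pow_lt.
have D : \rprod_(i : 'I_m) type_of x (x i) =
    \rprod_(a : X) INR (cnt a) ^ cnt a * / INR m ^ m.
  rewrite /type_of big_split /= rprod_const card_ord pow_inv; congr (_ * _).
  exact: (rprod_level x (fun a => INR (cnt a))).
rewrite D INR_prodn.
apply: Rle_trans (_ : \rprod_(a : X)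
   ((1 + INR m) ^ 2 * (INR (cnt a) ^ cnt a * exp (- INR (cnt a)))) <= _).
  apply: ler_rprod => a _; split; first exact: pos_INR.
  apply: Rle_trans (fact_le _) _; apply: Rmult_le_compat_r.
    apply: Rmult_le_pos; last exact/Rlt_le/exp_pos.
    by apply: pow_le; exact: pos_INR.
  have c0 := pos_INR (cnt a).
  apply: pow_incr; split; first by lra.
  suff : INR (cnt a) <= INR m by lra.
  by apply: le_INR; apply/leP; rewrite -[X in (_ <= X)%nat]card_ord max_card.
have [c2 c2E] : exists c2, c2 = (1 + INR m) ^ 2 by eexists.
rewrite -c2E !big_split /= rprod_const c2E -pow_mult multE -exp_rsum.
have -> : \rsum_(a : X) (- INR (cnt a)) = - INR m.
  rewrite -[in RHS](card_ord m) -(rsum_card_level x).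
  by elim/big_rec2: _ => [|a u v _ ->]; rewrite ?/cnt; lra.
have := fact_ge m => mfact.
have p0 : 0 <= \rprod_(a : X) INR (cnt a) ^ cnt a.
  by apply: rprod_ge0 => a _; apply: pow_le; exact: pos_INR.
have q0 : 0 <= (1 + INR m) ^ (2 * #|X|) by apply: pow_le; lra.
have e_le : exp (- INR m) <= INR m`! * / INR m ^ m.
  apply: (Rmult_le_reg_l (INR m ^ m)) => //.
  have -> : INR m ^ m * (INR m`! * / INR m ^ m) = INR m`! by field; lra.
  by [].
have := Rmult_le_compat_l _ _ _ (Rmult_le_pos _ _ q0 p0) e_le.
set a := (1 + INR m) ^ _; set b := \rprod_(_ : X) _; set c := exp _; set d := INR _.
set e := / _.
have -> : a * (b * c) = a * b * c by ring.
by have -> : d * a * (b * e) = a * b * (d * e) by ring.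
Qed.

(* Uniform permutations of [x] are uniform on its type class, which the i.i.d.
   law of the empirical distribution of [x] dominates up to a polynomial factor. *)
Lemma permanent_le (g : 'I_m -> X -> R) :
  (forall i a, 0 <= g i a) ->
  \rsum_(s : 'S_m) \rprod_(i : 'I_m) g i (x (s i)) <=
  INR m`! * (1 + INR m) ^ (2 * #|X|) *
  \rprod_(i : 'I_m) \rsum_(a : X) (type_of x a * g i a).
Proof.
move=> g0.
pose f (v : {ffun 'I_m -> X}) := \rprod_(i : 'I_m) g i (v i).
have f0 v : 0 <= f v by apply: rprod_ge0.
rewrite (eq_bigr (fun s : 'S_m => f [ffun i => x (s i)])); last first.
  by move=> s _; apply: eq_bigr => i _; rewrite ffunE.
apply: Rle_trans (rsum_perm_le x f0) _.
rewrite -rsum_ffun_prod.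
set O := [pred v : {ffun 'I_m -> X} | [exists s : 'S_m, [ffun i => x (s i)] == v]].
set D := \rprod_(i : 'I_m) type_of x (x i).
(* [D] is the i.i.d. probability common to all rearrangements of [x]; the words outside the orbit
   [O] contribute nonnegative terms to the i.i.d. expectation. *)
have OD : D * \big[Rplus/0]_(v | O v) f v <=
   \rsum_(v : {ffun 'I_m -> X}) \rprod_(i : 'I_m) (type_of x (v i) * g i (v i)).
  rewrite (bigID O predT) /= big_distrr /=.
  rewrite -[X in X <= _]Rplus_0_r; apply: Rplus_le_compat; last first.
    apply: rsum_ge0 => v _; apply: rprod_ge0 => i _.
    by apply: Rmult_le_pos => //; exact: type_of_ge0.
  apply: ler_rsum => v /existsP[s /eqP <-]; apply: Req_le.
  rewrite big_split /=; congr (_ * _).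
  rewrite /D (reindex_inj (@perm_inj _ s)) /=.
  by apply: eq_bigr => i _; rewrite ffunE.
have S0 : 0 <= \big[Rplus/0]_(v | O v) f v by apply: rsum_ge0.
have C0 : 0 <= INR m`! * (1 + INR m) ^ (2 * #|X|).
  apply: Rmult_le_pos; first exact: pos_INR.
  by apply: pow_le; have := pos_INR m; lra.
apply: Rle_trans (Rmult_le_compat_r _ _ _ S0 prod_fact_type_le) _.
rewrite Rmult_assoc; exact: Rmult_le_compat_l.
Qed.

End PermanentBound.

(** * The product channel as a probability law *)

Lemma Wn_ge0 (X Y : finType) (n : nat) (W : X -> Y -> R)
  (x : {ffun 'I_n -> X}) (y : {ffun 'I_n -> Y}) :
  stochastic W -> (0 <= Wn W x y)%R.
Proof. by case=> W0 _; apply: rprod_ge0. Qed.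

Lemma Wn_sum1 (X Y : finType) (n : nat) (W : X -> Y -> R)
  (x : {ffun 'I_n -> X}) :
  stochastic W -> \rsum_(y : {ffun 'I_n -> Y}) Wn W x y = 1%R.
Proof.
case=> _ W1; rewrite /Wn (rsum_ffun_prod (fun i => W (x i))).
by rewrite big1.
Qed.

(** * The selection scheme and the law of its selected blocks *)

Section BaseScheme.
Variables (X Y : finType) (S L m : nat) (h : selector X Y S L m).
Variables (xx : codearr X S L m) (s0 : 'I_S).

Notation outs := (outarr Y S L m).
Notation sels := (selarr S L).
Notation blocks := {ffun 'I_L -> {ffun 'I_m -> Y}}.

Definition next_sel (y1 y2 : outs) (b : sels) (l : 'I_L) : 'I_S :=
  h (xpre xx b l) (ypre y1 b l) (ypre y2 b l).

Definition consistent (y1 y2 : outs) (b : sels) : Prop :=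
  forall l, next_sel y1 y2 b l = b l.

Lemma next_sel_ext (y1 y2 y1' y2' : outs) (b b' : sels) (l : 'I_L) :
  (forall t : 'I_L, t < l -> [/\ b t = b' t, y1 t (b t) = y1' t (b t) &
     y2 t (b t) = y2' t (b t)]) ->
  next_sel y1 y2 b l = next_sel y1' y2' b' l.
Proof.
move=> ext; rewrite /next_sel.
have E (t : 'I_l) := ext (widen_ord (ltnW (ltn_ord l)) t) (ltn_ord t).
by congr h; apply/ffunP => t; rewrite !ffunE; have [<- e1 e2] := E t; rewrite ?e1 ?e2.
Qed.

(** Strong induction: the selection for block [l] reads only earlier blocks, so agreement before [n]
    fixes the selections up to and including [n]. Both uniqueness and causality of the selections
    follow from this. *)
Lemma consistent_ext (y1 y2 y1' y2' : outs) (b b' : sels) (n : nat) :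
  consistent y1 y2 b -> consistent y1' y2' b' ->
  (forall t : 'I_L, t < n -> y1 t (b t) = y1' t (b t) /\ y2 t (b t) = y2' t (b t)) ->
  forall l : 'I_L, l <= n -> b l = b' l.
Proof.
move=> cb cb' yE.
suff H k : forall l : 'I_L, l < k -> l <= n -> b l = b' l by move=> l; apply: (H l.+1).
elim: k => // k IH l lk ln.
rewrite -(cb l) -(cb' l); apply: next_sel_ext => t tl.
have [] := yE t (leq_trans tl ln).
split=> //; apply: IH; first exact: leq_trans tl _.
exact: leq_trans (ltnW tl) ln.
Qed.

(** After [n] rounds the first [n] entries are final and the others still hold the default [s0]. *)
Fixpoint sel_upto (y1 y2 : outs) (n : nat) : sels :=
  if n is n'.+1 then
    let b := sel_upto y1 y2 n' in
    [ffun l : 'I_L => if l == n' :> nat then next_sel y1 y2 b l else b l]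
  else [ffun=> s0].

Definition bsel (y1 y2 : outs) : sels := sel_upto y1 y2 L.

Lemma bsel_consistent (y1 y2 : outs) : consistent y1 y2 (bsel y1 y2).
Proof.
suff H n (l : 'I_L) : l < n ->
    next_sel y1 y2 (sel_upto y1 y2 n) l = sel_upto y1 y2 n l.
  by move=> l; apply: H.
elim: n => // n IH ln; rewrite [in RHS]/= ffunE.
have -> : next_sel y1 y2 (sel_upto y1 y2 n.+1) l = next_sel y1 y2 (sel_upto y1 y2 n) l.
  apply: next_sel_ext => t tl; split=> //.
  by rewrite /= ffunE ltn_eqF // (leq_trans tl).
case: eqP => // /eqP ln'; apply: IH.
by rewrite ltn_neqAle ln'.
Qed.

Lemma bsel_unique (y1 y2 : outs) (b : sels) :
  consistent y1 y2 b -> b = bsel y1 y2.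
Proof.
move=> cb; apply/ffunP => l.
by apply: (consistent_ext (n := L) cb (bsel_consistent y1 y2)) => //; exact: ltnW.
Qed.

Definition picked (y : outs) (b : sels) : blocks := [ffun l => y l (b l)].
(** Every branch receives the same block, so the selection rule can be run on the chosen blocks
    alone, which are all that a real encoder observes. *)
Definition spread (z : blocks) : outs := [ffun l => [ffun=> z l]].
Definition bz (z1 z2 : blocks) : sels := bsel (spread z1) (spread z2).

Lemma bz_causal (z1 z2 z1' z2' : blocks) (n : nat) :
  (forall t : 'I_L, t < n -> z1 t = z1' t /\ z2 t = z2' t) ->
  forall l : 'I_L, l <= n -> bz z1 z2 l = bz z1' z2' l.
Proof.
move=> zE; apply: consistent_ext (bsel_consistent _ _) (bsel_consistent _ _) _.
by move=> t tn; rewrite !ffunE; have [-> ->] := zE t tn.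
Qed.

(** The rule reads only branches that it picked, so the event depends on the arrays through their
    picked blocks. This is what allows the other branches to be integrated out. *)
Lemma eq_bsel_bz (y1 y2 : outs) (b : sels) :
  (b == bsel y1 y2) = (b == bz (picked y1 b) (picked y2 b)).
Proof.
apply/eqP/eqP => [bE|bE]; apply: bsel_unique => l.
  rewrite -[in RHS](_ : next_sel y1 y2 b l = b l); last first.
    by rewrite bE; exact: bsel_consistent.
  by apply: next_sel_ext => t _; rewrite !ffunE.
rewrite -[in RHS](_ : next_sel (spread (picked y1 b)) (spread (picked y2 b)) b l = b l).
  by apply: next_sel_ext => t _; rewrite !ffunE.
by rewrite [in X in next_sel _ _ X l]bE [in RHS]bE; exact: bsel_consistent.
Qed.

Local Open Scope R_scope.
Variables (W1 W2 : X -> Y -> R).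
Hypotheses (sW1 : stochastic W1) (sW2 : stochastic W2).

Definition block_prob (W : X -> Y -> R) (b : sels) (z : blocks) : R :=
  \rprod_(l : 'I_L) Wn W (xx l (b l)) (z l).

Definition array_prob (W : X -> Y -> R) (y : outs) : R :=
  \rprod_(l : 'I_L) \rprod_(s : 'I_S) Wn W (xx l s) (y l s).

(** The law of the outputs when only the selected branch of each block is transmitted. *)
Definition scheme_prob (z1 z2 : blocks) : R :=
  block_prob W1 (bz z1 z2) z1 * block_prob W2 (bz z1 z2) z2.

Lemma block_prob_ge0 W b z : stochastic W -> 0 <= block_prob W b z.
Proof. by move=> sW; apply: rprod_ge0 => l _; exact: Wn_ge0. Qed.

Lemma scheme_prob_ge0 z1 z2 : 0 <= scheme_prob z1 z2.
Proof. by apply: Rmult_le_pos; exact: block_prob_ge0. Qed.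

(** By uniqueness of the consistent selection, the product of the indicators in [joint] is 1 at
    [bsel y1 y2] and 0 elsewhere. *)
Lemma jointE (y1 y2 : outs) (b : sels) :
  joint W1 W2 h xx y1 y2 b =
  array_prob W1 y1 * array_prob W2 y2 * (if b == bsel y1 y2 then 1 else 0).
Proof.
rewrite /joint big_split /=; congr (_ * _).
  rewrite /array_prob -big_split /=; apply: eq_bigr => l _.
  by rewrite -big_split.
case: eqP => [->|bN].
  by apply: big1 => l _; rewrite ifT //; apply/eqP; exact: bsel_consistent.
have /existsP[l lN] : [exists l, next_sel y1 y2 b l != b l].
  apply: contraT => /existsPn cb; case: bN; apply: bsel_unique => l.
  by apply/eqP; rewrite -[_ == _]negbK cb.
by rewrite (bigD1 l) //= ifN // Rmult_0_l.
Qed.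

Lemma array_prob_fiber W (b : sels) (z : blocks) : stochastic W ->
  \big[Rplus/0]_(y : outs | picked y b == z) array_prob W y = block_prob W b z.
Proof.
move=> sW.
(* The constraint [picked y b == z] is distributed over the entries as 0/1 factors, so that the sum
   over arrays factorises; the unselected factors then sum to 1. *)
pose G l s (v : {ffun 'I_m -> Y}) :=
  Wn W (xx l s) v * (if (s == b l) && (v != z l) then 0 else 1).
transitivity (\rsum_(y : outs) \rprod_(l : 'I_L) \rprod_(s : 'I_S) G l s (y l s)).
  rewrite big_mkcond /=; apply: eq_bigr => y _.
  case: eqP => [yz|yz].
    apply: eq_bigr => l _; apply: eq_bigr => s _; rewrite /G.
    case: eqP => [->|]; last by rewrite Rmult_1_r.
    by rewrite -yz ffunE eqxx Rmult_1_r.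
  have /existsP[l lN] : [exists l, y l (b l) != z l].
    apply: contraT => /existsPn yE; case: yz; apply/ffunP => l.
    by rewrite ffunE; apply/eqP; rewrite -[_ == _]negbK yE.
  by rewrite (bigD1 l) //= (bigD1 (b l)) //= /G eqxx lN /= Rmult_0_r !Rmult_0_l.
rewrite (rsum_ffun_prod (fun l (v : {ffun 'I_S -> {ffun 'I_m -> Y}}) =>
  \rprod_(s : 'I_S) G l s (v s))).
apply: eq_bigr => l _; rewrite (rsum_ffun_prod (G l)) (bigD1 (b l)) //=.
rewrite [X in _ * X]big1 ?Rmult_1_r => [|s /negbTE sb].
  rewrite -[RHS](rsum_indicator (z l)); apply: eq_bigr => v _.
  by rewrite /G eqxx /=; case: eqP.
rewrite -[RHS](Wn_sum1 (xx l s) sW); apply: eq_bigr => v _.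
by rewrite /G sb Rmult_1_r.
Qed.

Lemma array_prob_sum1 W : stochastic W -> \rsum_(y : outs) array_prob W y = 1.
Proof.
move=> sW; rewrite /array_prob (rsum_ffun_prod (fun l (v : {ffun 'I_S -> {ffun 'I_m -> Y}}) =>
  \rprod_(s : 'I_S) Wn W (xx l s) (v s))).
apply: big1 => l _; rewrite (rsum_ffun_prod (fun s => Wn W (xx l s))).
by apply: big1 => s _; exact: Wn_sum1.
Qed.

(* The outputs of the branches that are not selected integrate out, so the law
   [joint] and the channel actually used see the same selected blocks. *)
Lemma sum_joint (F : blocks -> blocks -> sels -> R) :
  \rsum_(y1 : outs) \rsum_(y2 : outs) \rsum_(b : sels)
    (joint W1 W2 h xx y1 y2 b * F (picked y1 b) (picked y2 b) b) =
  \rsum_(z1 : blocks) \rsum_(z2 : blocks)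
    (scheme_prob z1 z2 * F z1 z2 (bz z1 z2)).
Proof.
(* With [b] summed outermost, the arrays can be grouped by their blocks picked along [b]. *)
transitivity (\rsum_(b : sels) \rsum_(z1 : blocks) \rsum_(z2 : blocks)
   (block_prob W1 b z1 * block_prob W2 b z2 * F z1 z2 b *
    (if b == bz z1 z2 then 1 else 0))); last first.
  rewrite exchange_big; apply: eq_bigr => z1 _.
  rewrite exchange_big; apply: eq_bigr => z2 _.
  exact: (rsum_indicator (bz z1 z2)
    (fun b => block_prob W1 b z1 * block_prob W2 b z2 * F z1 z2 b)).
under eq_bigr => y1 _ do rewrite exchange_big /=.
rewrite exchange_big /=; apply: eq_bigr => b _.
rewrite (partition_big (fun y => picked y b) predT) //=; apply: eq_bigr => z1 _.
transitivity (\big[Rplus/0]_(y1 : outs | picked y1 b == z1) \rsum_(z2 : blocks)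
   (array_prob W1 y1 * (block_prob W2 b z2 * F z1 z2 b *
    (if b == bz z1 z2 then 1 else 0)))).
  apply: eq_bigr => y1 /eqP y1E.
  rewrite (partition_big (fun y => picked y b) predT) //=; apply: eq_bigr => z2 _.
  rewrite -(array_prob_fiber b z2 sW2) !big_distrl big_distrr /=.
  apply: eq_bigr => y2 /eqP y2E.
  by rewrite jointE eq_bsel_bz y1E y2E; ring.
rewrite exchange_big /=; apply: eq_bigr => z2 _.
by rewrite -big_distrl /= array_prob_fiber //; ring.
Qed.

Lemma scheme_prob_sum1 :
  \rsum_(z1 : blocks) \rsum_(z2 : blocks) scheme_prob z1 z2 = 1.
Proof.
have := sum_joint (fun _ _ _ => 1).
under [RHS]eq_bigr => z1 _ do under eq_bigr => z2 _ do rewrite Rmult_1_r.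
move=> <-; rewrite -[RHS](array_prob_sum1 sW1); apply: eq_bigr => y1 _.
transitivity (\rsum_(y2 : outs) (array_prob W1 y1 * array_prob W2 y2)).
  apply: eq_bigr => y2 _.
  rewrite -[RHS](rsum_indicator (bsel y1 y2) (fun=> array_prob W1 y1 * array_prob W2 y2)).
  by apply: eq_bigr => b _; rewrite jointE Rmult_1_r.
by rewrite -big_distrr /= array_prob_sum1 // Rmult_1_r.
Qed.

End BaseScheme.

(** * Interleavers and the likelihood-ratio test *)

Section ThresholdTest.
Local Open Scope R_scope.
Variables (X Y : finType) (S L m : nat) (xx : codearr X S L m).
Variables (P : 'I_S -> X -> R) (W : X -> Y -> R) (gamma : R).
Hypotheses (m_gt0 : (0 < m)%nat) (xxP : in_F P xx) (sW : stochastic W).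

Notation outs := (outarr Y S L m).
Notation sels := (selarr S L).
Notation blocks := {ffun 'I_L -> {ffun 'I_m -> Y}}.
Notation interleaver := {ffun 'I_L -> 'S_m}.

(** Slot [i] of block [l] will carry position [p l i] of the codeword block; the outputs are put
    back in codeword order. *)
Definition deint (p : interleaver) (z : blocks) : blocks :=
  [ffun l => [ffun i => z l ((p l)^-1 i)%g]].

Lemma deintE p z l i : deint p z l (p l i) = z l i.
Proof. by rewrite !ffunE permK. Qed.

Lemma deint_inj p : injective (deint p).
Proof.
move=> z z' zz'; apply/ffunP => l; apply/ffunP => i.
by rewrite -(deintE p z l i) zz' deintE.
Qed.

Definition ref_prob (b : sels) (z : blocks) : R :=
  \rprod_(l : 'I_L) \rprod_(i : 'I_m) output_dist (P (b l)) W (z l i).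

(* Unlike a test on [info_L], this product form is not affected by the junk
   value [ln 0 = 0]. *)
Definition passes (z : blocks) (b : sels) : bool :=
  if Rle_dec (block_prob xx W b z) (exp gamma * ref_prob b z) then false else true.

Lemma output_dist_type l s y :
  output_dist (P s) W y = \rsum_(a : X) (type_of (xx l s) a * W a y).
Proof. by apply: eq_bigr => a _; rewrite xxP. Qed.

(** The block index [l] supplies a codeword block whose type is [P s], hence the sign of the
    weights. *)
Lemma output_dist_ge0 (l : 'I_L) s y : 0 <= output_dist (P s) W y.
Proof.
rewrite (output_dist_type l); apply: rsum_ge0 => a _.
by apply: Rmult_le_pos; [exact: type_of_ge0 | case: sW].
Qed.

Lemma output_dist_gt0 l s i y :
  0 < W (xx l s i) y -> 0 < output_dist (P s) W y.
Proof.
move=> W0; rewrite (output_dist_type l).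
apply: Rlt_le_trans (rsum_ge_term (i := xx l s i) _ _) => //.
  by apply: Rmult_lt_0_compat => //; exact: type_of_gt0.
by move=> a _; apply: Rmult_le_pos; [exact: type_of_ge0 | case: sW].
Qed.

Lemma ref_prob_ge0 b z : 0 <= ref_prob b z.
Proof.
by apply: rprod_ge0 => l _; apply: rprod_ge0 => i _; exact: output_dist_ge0.
Qed.

Lemma ref_prob_deint p b z : ref_prob b (deint p z) = ref_prob b z.
Proof.
apply: eq_bigr => l _; rewrite (reindex_inj (@perm_inj _ (p l))) /=.
by apply: eq_bigr => i _; rewrite deintE.
Qed.

Lemma block_prob_deint p b z :
  block_prob xx W b (deint p z) =
  \rprod_(l : 'I_L) \rprod_(i : 'I_m) W (xx l (b l) (p l i)) (z l i).
Proof.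
apply: eq_bigr => l _; rewrite /Wn (reindex_inj (@perm_inj _ (p l))) /=.
by apply: eq_bigr => i _; rewrite deintE.
Qed.

Lemma card_interleaver : INR #|{: interleaver}| = INR m`! ^ L.
Proof.
rewrite card_ffun card_ord.
have -> : #|{: 'S_m}| = m`! by rewrite -(card_Sn m); apply: eq_card => s; rewrite !inE.
elim: (L) => //= n IH; by rewrite expnS mult_INR IH.
Qed.

(** The blocks are interleaved independently, so the sum over interleavers is a product over blocks,
    and [permanent_le] applies to each factor. *)
Lemma sum_block_prob_deint b z :
  \rsum_(p : interleaver) block_prob xx W b (deint p z) <=
  INR #|{: interleaver}| * (1 + INR m) ^ (2 * L * #|X|) * ref_prob b z.
Proof.
under eq_bigr => p _ do rewrite block_prob_deint.
rewrite (rsum_ffun_prod (fun l (s : 'S_m) =>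
  \rprod_(i : 'I_m) W (xx l (b l) (s i)) (z l i))).
apply: Rle_trans (_ : \rprod_(l : 'I_L) (INR m`! * (1 + INR m) ^ (2 * #|X|) *
    \rprod_(i : 'I_m) output_dist (P (b l)) W (z l i)) <= _).
  apply: ler_rprod => l _; split.
    apply: rsum_ge0 => s _; apply: rprod_ge0 => i _; by case: sW.
  under [X in _ <= _ * X]eq_bigr => i _ do rewrite (output_dist_type l).
  by apply: (permanent_le (xx l (b l)) m_gt0 (g := fun i a => W a (z l i))); case: sW.
apply: Req_le; rewrite big_split /=; congr (_ * _).
rewrite rprod_const card_ord Rpow_mult_distr card_interleaver -pow_mult multE.
by rewrite mulnAC.
Qed.

(** Markov's inequality: passing costs likelihood above [exp gamma] times the reference probability,
    which deinterleaving leaves unchanged. *)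
Lemma sum_passes_deint b z :
  \rsum_(p : interleaver) (if passes (deint p z) b then 1 else 0) <=
  INR #|{: interleaver}| * (exp (- gamma) * (1 + INR m) ^ (2 * L * #|X|)).
Proof.
have := sum_block_prob_deint b z.
set N := INR _; set C := _ ^ _; set Q := ref_prob b z => sumW.
have W0 p : 0 <= block_prob xx W b (deint p z) by exact: block_prob_ge0.
have eg := exp_pos gamma.
have ee : exp (- gamma) * exp gamma = 1 by rewrite -exp_plus Rplus_opp_l exp_0.
(* If the reference probability is 0, the averaged bound forces every likelihood to vanish and no
   interleaver passes the strict test. *)
case: (Rle_lt_or_eq_dec _ _ (ref_prob_ge0 b z)) => [Q0|Q0]; last first.
  rewrite big1.
    apply: Rmult_le_pos; first exact: pos_INR.
    apply: Rmult_le_pos; first exact/Rlt_le/exp_pos.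
    by apply: pow_le; have := pos_INR m; lra.
  move=> p _; rewrite /passes; case: Rle_dec => // H; case: H.
  rewrite ref_prob_deint -Q0 Rmult_0_r; move: sumW; rewrite /Q -Q0 Rmult_0_r.
  by apply: Rle_trans; exact: (rsum_ge_term (i := p)).
rewrite -/Q in Q0.
apply: Rle_trans (_ : \rsum_(p : interleaver)
   (block_prob xx W b (deint p z) * (exp (- gamma) * / Q)) <= _).
  apply: ler_rsum => p _; rewrite /passes ref_prob_deint -/Q.
  have cQ : 0 < exp (- gamma) * / Q.
    by apply: Rmult_lt_0_compat; [exact: exp_pos | exact: Rinv_0_lt_compat].
  case: Rle_dec => H /=; last move/Rnot_le_lt: H => lt.
    by apply: Rmult_le_pos; [exact: W0 | lra].
  have := Rmult_le_compat_r _ _ _ (Rlt_le _ _ cQ) (Rlt_le _ _ lt).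
  have -> : exp gamma * Q * (exp (- gamma) * / Q) =
      (exp (- gamma) * exp gamma) * (Q * / Q) by ring.
  by rewrite ee Rinv_r; lra.
rewrite -big_distrl /=.
have cQ : 0 <= exp (- gamma) * / Q.
  by apply/Rlt_le/Rmult_lt_0_compat; [exact: exp_pos | exact: Rinv_0_lt_compat].
apply: Rle_trans (Rmult_le_compat_r _ _ _ cQ sumW) _.
apply: Req_le; field; lra.
Qed.

(** Nonzero likelihood makes the argument of every logarithm positive, so [exp (info_L ...)] is the
    true likelihood ratio, and failing the test bounds it by [exp gamma]. *)
Lemma info_L_le (y : outs) (b : sels) :
  block_prob xx W b (picked y b) <> 0 -> ~~ passes (picked y b) b ->
  info_L P W xx y b <= gamma.
Proof.
move=> nz.
have W_gt0 l i : 0 < W (xx l (b l) i) (y l (b l) i).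
  have := rprod_neq0 (i := l) nz; rewrite /Wn ffunE => /(rprod_neq0 (i := i)).
  by have : 0 <= W (xx l (b l) i) (y l (b l) i); [case: sW | lra].
have Q_gt0 l i : 0 < output_dist (P (b l)) W (y l (b l) i).
  exact: output_dist_gt0 (W_gt0 l i).
have infoE : exp (info_L P W xx y b) * ref_prob b (picked y b) =
    block_prob xx W b (picked y b).
  rewrite /info_L exp_rsum /ref_prob -big_split /=; apply: eq_bigr => l _.
  rewrite exp_rsum /Wn -big_split /=; apply: eq_bigr => i _.
  rewrite ffunE /info_dens exp_ln; last exact: Rdiv_lt_0_compat.
  by have := Q_gt0 l i => ?; field; lra.
have ref_gt0 : 0 < ref_prob b (picked y b).
  by apply: rprod_gt0 => l _; apply: rprod_gt0 => i _; rewrite ffunE.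
rewrite /passes; case: Rle_dec => // H _; move: H; rewrite -infoE => /Rmult_le_reg_r le.
have {}le := le ref_gt0.
by apply: Rnot_lt_le => /exp_increasing; lra.
Qed.

End ThresholdTest.

(** * Greedy selection and cyclic relabelling *)

Lemma greedy_choice (T : finType) (c : nat -> nat -> T -> T -> R) (beta : R) :
  0 < #|T| -> (0 <= beta)%R ->
  (forall i j t, (\rsum_(t' : T) c i j t t' <= INR #|T| * beta)%R) ->
  forall M : nat, exists C : nat -> T,
    (\rsum_(j : 'I_M) \rsum_(i : 'I_j) c i j (C i) (C j) <=
     INR M * INR M * beta / 2)%R.
Proof.
move=> T0 b0 c_le; elim=> [|M [C IH]].
  case/card_gt0P: T0 => t _; exists (fun=> t).
  by rewrite big_ord0 /=; lra.
(* The new element has at most average total cost against those already fixed, and the induction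
   closes by [M^2/2 + M <= (M+1)^2/2]. Averaging over the later element of each pair is enough. *)
have [t tP] : exists t, (\rsum_(i : 'I_M) c i M (C i) t <= INR M * beta)%R.
  apply: rsum_exists_le => //; rewrite exchange_big /=.
  apply: Rle_trans (_ : (\rsum_(i : 'I_M) (INR #|T| * beta) <= _)%R).
    by apply: ler_rsum => i _; exact: c_le.
  rewrite rsum_const card_ord -!Rmult_assoc; apply: Req_le.
  by congr Rmult; exact: Rmult_comm.
exists (fun n => if n == M then t else C n).
rewrite S_INR big_ord_recr /= eqxx.
have -> : (\rsum_(i : 'I_M) c i M (if (i : nat) == M then t else C i) t =
   \rsum_(i : 'I_M) c i M (C i) t)%R.
  by apply: eq_bigr => i _; rewrite ltn_eqF.
have -> : (\rsum_(j : 'I_M) \rsum_(i : 'I_j) c i j (if (i : nat) == M then t else C i)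
    (if (j : nat) == M then t else C j) =
   \rsum_(j : 'I_M) \rsum_(i : 'I_j) c i j (C i) (C j))%R.
  apply: eq_bigr => j _; apply: eq_bigr => i _.
  by rewrite !ltn_eqF // (ltn_trans (ltn_ord i)).
apply: Rle_trans (Rplus_le_compat _ _ _ _ IH tP) _; nra.
Qed.

(** The addition table modulo [K] is a Latin square: each shift [c] is invertible, and for a fixed
    [t] the label determines [c]. *)
Lemma cyclic_relabelling (T : finType) (K : nat) :
  #|T| = K -> 0 < K ->
  exists (phi : 'I_K -> T -> 'I_K) (psi : 'I_K -> 'I_K -> T),
    (forall c, cancel (phi c) (psi c)) /\ (forall t, injective (phi^~ t)).
Proof.
move=> cardT K0.
have t0 : T by have /card_gt0P/sigW[] : 0 < #|T| by rewrite cardT.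
have rk (t : T) : enum_rank t < K by rewrite -[X in _ < X]cardT.
pose phi (c : 'I_K) (t : T) := Ordinal (ltn_pmod (c + enum_rank t) K0).
pose psi c i := odflt t0 [pick t | phi c t == i].
exists phi, psi; split=> [c t|t c c' /(congr1 val) /=].
  rewrite /psi; case: pickP => [u|/(_ t)]; last by rewrite eqxx.
  move=> /eqP/(congr1 val) /= /eqP; rewrite eqn_modDl !modn_small ?rk // => /eqP.
  by move=> /val_inj/enum_rank_inj.
move=> /eqP; rewrite eqn_modDr !modn_small // => /eqP; exact: val_inj.
Qed.

(** * Channel uses indexed by blocks and positions, followed by a tail *)

Section RowMajor.
Variables A B : nat.

Lemma mul_ord_proof (l : 'I_A) (i : 'I_B) : l * B + i < A * B.
Proof.
apply: leq_trans (_ : l.+1 * B <= _); last by rewrite leq_mul2r ltn_ord orbT.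
by rewrite mulSn addnC ltn_add2r.
Qed.
Definition mul_ord l i := Ordinal (mul_ord_proof l i).

Lemma mul_ord_gt0 (a : 'I_(A * B)) : 0 < B.
Proof. by case: B a => // -[a]; rewrite muln0. Qed.

Lemma quo_ord_proof (a : 'I_(A * B)) : a %/ B < A.
Proof. by rewrite ltn_divLR ?(mul_ord_gt0 a). Qed.
Definition quo_ord a := Ordinal (quo_ord_proof a).
Definition rem_ord (a : 'I_(A * B)) := Ordinal (ltn_pmod a (mul_ord_gt0 a)).

Lemma mul_ordK a : mul_ord (quo_ord a) (rem_ord a) = a.
Proof. by apply: val_inj; rewrite /= -divn_eq. Qed.

Lemma quo_mul_ord l i : quo_ord (mul_ord l i) = l.
Proof.
apply: val_inj => /=; rewrite divnMDl ?(leq_trans _ (ltn_ord i)) //.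
by rewrite divn_small // addn0.
Qed.

Lemma rem_mul_ord l i : rem_ord (mul_ord l i) = i.
Proof. by apply: val_inj => /=; rewrite modnMDl modn_small. Qed.

Lemma big_mul_ord (V : Type) (idx : V) (op : Monoid.com_law idx) (F : 'I_(A * B) -> V) :
  \big[op/idx]_(a < A * B) F a = \big[op/idx]_(l < A) \big[op/idx]_(i < B) F (mul_ord l i).
Proof.
rewrite pair_bigA (reindex (fun u : 'I_A * 'I_B => mul_ord u.1 u.2)) //=.
exists (fun a => (quo_ord a, rem_ord a)) => [[l i] _ | a _] /=.
  by rewrite quo_mul_ord rem_mul_ord.
exact: mul_ordK.
Qed.

End RowMajor.

Section BlockDecomposition.
Variables (Y : finType) (L m nB : nat).
Notation blocks := {ffun 'I_L -> {ffun 'I_m -> Y}}.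
Notation words n := {ffun 'I_n -> Y}.

Definition head_blocks (y : words (L * m + nB)) : blocks :=
  [ffun l => [ffun i => y (lshift nB (mul_ord l i))]].
Definition tail_word (y : words (L * m + nB)) : words nB :=
  [ffun t => y (rshift (L * m) t)].
Definition glue (z : blocks) (w : words nB) : words (L * m + nB) :=
  [ffun i => match fintype.split i with
    inl a => z (quo_ord a) (rem_ord a) | inr t => w t end].

Lemma glue_lshift z w a : glue z w (lshift nB a) = z (quo_ord a) (rem_ord a).
Proof.
rewrite ffunE; case: splitP => [b /= ab | t /= at_].
  by rewrite (_ : a = b) //; apply: val_inj.
by have := ltn_ord a; rewrite at_ ltnNge leq_addr.
Qed.

Lemma glue_rshift z w t : glue z w (rshift (L * m) t) = w t.
Proof.
rewrite ffunE; case: splitP => [b /= bt | u /= tu].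
  by have := ltn_ord b; rewrite -bt ltnNge leq_addr.
by congr (w _); apply/esym/val_inj/(addnI tu).
Qed.

Lemma head_glue z w : head_blocks (glue z w) = z.
Proof.
apply/ffunP => l; apply/ffunP => i; rewrite 2!ffunE glue_lshift.
by rewrite quo_mul_ord rem_mul_ord.
Qed.

Lemma tail_glue z w : tail_word (glue z w) = w.
Proof. by apply/ffunP => t; rewrite ffunE glue_rshift. Qed.

Lemma glueK y : glue (head_blocks y) (tail_word y) = y.
Proof.
apply/ffunP => i; rewrite ffunE; case: splitP => [a ia | t it].
  by rewrite !ffunE mul_ordK; congr (y _); apply: val_inj.
by rewrite !ffunE; congr (y _); apply: val_inj.
Qed.

Lemma rsum_glue (F : words (L * m + nB) -> R) :
  \rsum_(y : words (L * m + nB)) F y =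
  \rsum_(z : blocks) \rsum_(w : words nB) F (glue z w).
Proof.
rewrite pair_bigA (reindex (fun u : blocks * words nB => glue u.1 u.2)) //=.
exists (fun y => (head_blocks y, tail_word y)) => [[z w] _ | y _] /=.
  by rewrite head_glue tail_glue.
exact: glueK.
Qed.

End BlockDecomposition.

(** * Padding of output prefixes *)

Section Prefixes.
Variables (Y : finType) (n : nat) (y0 : Y).

(** This lets an encoder be described on full output words; causality makes the padding value [y0]
    irrelevant. *)
Definition extend (i : nat) (u : {ffun 'I_i -> Y}) : {ffun 'I_n -> Y} :=
  [ffun t => if insub (val t) is Some t' then u t' else y0].

Lemma extend_prefix (i : 'I_n) (y : {ffun 'I_n -> Y}) (t : 'I_n) :
  t < i -> extend (Defs.prefix i y) t = y t.
Proof.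
move=> ti; rewrite ffunE insubT ffunE; congr (y _); exact: val_inj.
Qed.

End Prefixes.

(** * The channel inputs of one message and the output law they induce *)

Section FeedbackScheme.
Variables (X Y : finType) (S L m nB K : nat) (h : selector X Y S L m).
Variables (xx : codearr X S L m) (s0 : 'I_S).
Variables (encB : 'I_K -> {ffun 'I_nB -> X}).
Variables (phi : 'I_K -> selarr S L -> 'I_K).

Notation n := (L * m + nB).
Notation sels := (selarr S L).
Notation blocks := {ffun 'I_L -> {ffun 'I_m -> Y}}.
Notation words n := {ffun 'I_n -> Y}.
Notation interleaver := {ffun 'I_L -> 'S_m}.

Definition sel_of (p : interleaver) (y1 y2 : words n) : sels :=
  bz h xx s0 (deint p (head_blocks y1)) (deint p (head_blocks y2)).

Definition input (p : interleaver) (c : 'I_K) (y1 y2 : words n) (i : 'I_n) : X :=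
  match fintype.split i with
  | inl a => xx (quo_ord a) (sel_of p y1 y2 (quo_ord a)) (p (quo_ord a) (rem_ord a))
  | inr t => encB (phi c (sel_of p y1 y2)) t
  end.

Lemma input_lshift p c y1 y2 l i :
  input p c y1 y2 (lshift nB (mul_ord l i)) = xx l (sel_of p y1 y2 l) (p l i).
Proof.
rewrite /input; case: splitP => [b /= ab | t /= at_].
  have -> : b = mul_ord l i by apply: val_inj.
  by rewrite quo_mul_ord rem_mul_ord.
by have := ltn_ord (mul_ord l i); rewrite /= at_ ltnNge leq_addr.
Qed.

Lemma input_rshift p c y1 y2 t :
  input p c y1 y2 (rshift (L * m) t) = encB (phi c (sel_of p y1 y2)) t.
Proof.
rewrite /input; case: splitP => [b /= bt | u /= tu].
  by have := ltn_ord b; rewrite -bt ltnNge leq_addr.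
by congr (encB _ _); apply/esym/val_inj/(addnI tu).
Qed.

(** Deinterleaving permutes only within blocks. The selection for the current block needs only
    complete earlier blocks, and the tail starts after all [L] blocks. *)
Lemma input_causal p c (y1 y2 y1' y2' : words n) (i : 'I_n) :
  (forall t : 'I_n, t < i -> y1 t = y1' t /\ y2 t = y2' t) ->
  input p c y1 y2 i = input p c y1' y2' i.
Proof.
move=> yE; rewrite /input; case: splitP => [a ia | t it].
  congr (xx _ _ _); apply: (bz_causal h xx s0 (n := quo_ord a)) => // t ta.
  have E (u : 'I_m) := yE (lshift nB (mul_ord t u)) _.
  have ti (u : 'I_m) : lshift nB (mul_ord t u) < i.
    rewrite ia [X in _ < X](divn_eq a m) /=.
    apply: leq_trans (_ : t.+1 * m <= _).
      by rewrite mulSn addnC ltn_add2r.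
    by apply: leq_trans (leq_addr _ _); rewrite leq_mul2r ta orbT.
  by split; apply/ffunP => u; rewrite !ffunE; have [] := E ti ((p t)^-1 u)%g.
congr (encB (phi c _) _); apply/ffunP => l; apply: (bz_causal h xx s0 (n := L)); last exact: ltnW.
move=> {}l _.
have E (u : 'I_m) := yE (lshift nB (mul_ord l u)) _.
have ti (u : 'I_m) : lshift nB (mul_ord l u) < i.
  by rewrite it ltn_addr //; exact: (ltn_ord (mul_ord l u)).
by split; apply/ffunP => u; rewrite !ffunE; have [] := E ti ((p l)^-1 u)%g.
Qed.

Local Open Scope R_scope.
Variables (W1 W2 : X -> Y -> R).
Hypotheses (sW1 : stochastic W1) (sW2 : stochastic W2).

Definition msg_prob (p : interleaver) (c : 'I_K) (y1 y2 : words n) : R :=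
  \rprod_(i : 'I_n) (W1 (input p c y1 y2 i) (y1 i) * W2 (input p c y1 y2 i) (y2 i)).

Lemma msg_prob_ge0 p c y1 y2 : 0 <= msg_prob p c y1 y2.
Proof.
by apply: rprod_ge0 => i _; apply: Rmult_le_pos; [case: sW1 | case: sW2].
Qed.

Definition code_prob (i : 'I_K) (w1 w2 : words nB) : R :=
  Wn W1 (encB i) w1 * Wn W2 (encB i) w2.

Lemma msg_prob_glue p c z1 w1 z2 w2 :
  msg_prob p c (glue z1 w1) (glue z2 w2) =
  scheme_prob h xx s0 W1 W2 (deint p z1) (deint p z2) *
  code_prob (phi c (bz h xx s0 (deint p z1) (deint p z2))) w1 w2.
Proof.
rewrite /msg_prob big_split_ord /= big_mul_ord; congr (_ * _).
  rewrite /scheme_prob !block_prob_deint -big_split /=; apply: eq_bigr => l _.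
  rewrite -big_split /=; apply: eq_bigr => i _.
  by rewrite input_lshift !glue_lshift quo_mul_ord rem_mul_ord /sel_of !head_glue.
rewrite /code_prob /Wn -big_split /=; apply: eq_bigr => t _.
by rewrite input_rshift !glue_rshift /sel_of !head_glue.
Qed.

(** [deint p] is a bijection, so a change of variables removes [p]: in deinterleaved coordinates
    messages differ only by their relabelling [phi c]. *)
Lemma sum_msg_prob p c (F : blocks -> blocks -> words nB -> words nB -> R) :
  \rsum_(y1 : words n) \rsum_(y2 : words n) (msg_prob p c y1 y2 *
    F (deint p (head_blocks y1)) (deint p (head_blocks y2)) (tail_word y1) (tail_word y2)) =
  \rsum_(z1 : blocks) \rsum_(z2 : blocks) (scheme_prob h xx s0 W1 W2 z1 z2 *
    \rsum_(w1 : words nB) \rsum_(w2 : words nB)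
       (code_prob (phi c (bz h xx s0 z1 z2)) w1 w2 * F z1 z2 w1 w2)).
Proof.
rewrite rsum_glue [RHS](reindex_inj (@deint_inj _ _ _ p)) /=.
apply: eq_bigr => z1 _.
transitivity (\rsum_(w1 : words nB) \rsum_(z2 : blocks) \rsum_(w2 : words nB)
  (msg_prob p c (glue z1 w1) (glue z2 w2) * F (deint p z1) (deint p z2) w1 w2)).
  apply: eq_bigr => w1 _; rewrite rsum_glue; apply: eq_bigr => z2 _.
  by apply: eq_bigr => w2 _; rewrite !head_glue !tail_glue.
rewrite exchange_big [RHS](reindex_inj (@deint_inj _ _ _ p)) /=.
apply: eq_bigr => z2 _; rewrite big_distrr; apply: eq_bigr => w1 _.
rewrite big_distrr; apply: eq_bigr => w2 _.
by rewrite msg_prob_glue Rmult_assoc.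
Qed.

Lemma code_prob_sum1 i : \rsum_(w1 : words nB) \rsum_(w2 : words nB) code_prob i w1 w2 = 1.
Proof.
rewrite -(Wn_sum1 (encB i) sW1); apply: eq_bigr => w1 _.
by rewrite -big_distrr /= Wn_sum1 // Rmult_1_r.
Qed.

Lemma msg_prob_sum1 p c : \rsum_(y1 : words n) \rsum_(y2 : words n) msg_prob p c y1 y2 = 1.
Proof.
have := sum_msg_prob p c (fun _ _ _ _ => 1).
under eq_bigr => y1 _ do under eq_bigr => y2 _ do rewrite Rmult_1_r.
move=> ->; rewrite -[RHS](scheme_prob_sum1 h xx s0 sW1 sW2).
apply: eq_bigr => z1 _; apply: eq_bigr => z2 _.
under eq_bigr => w1 _ do under eq_bigr => w2 _ do rewrite Rmult_1_r.
by rewrite code_prob_sum1 Rmult_1_r.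
Qed.

End FeedbackScheme.

(** * Decoding to the last message that passes *)

Section LastHitDecoder.
Variables (A : finType) (M : nat) (j0 : 'I_M) (hit : nat -> A -> bool).

Definition last_hit (y : A) : 'I_M :=
  odflt j0 [pick j : 'I_M | hit j y && [forall j' : 'I_M, (j < j') ==> ~~ hit j' y]].

Lemma last_hit_neq (y : A) (j : 'I_M) :
  last_hit y != j -> hit j y -> exists2 j' : 'I_M, j < j' & hit j' y.
Proof.
rewrite /last_hit => dj hj; apply/exists_inP; apply: contraR dj.
move=> /exists_inPn later.
case: pickP => [i /andP[hi /forallP last]|/(_ j)] /=; last first.
  rewrite hj /= => /negbT/forallPn[j']; rewrite negb_imply negbK => /andP[jj' hj'].
  by have := later j' jj'; rewrite hj'.
rewrite -val_eqE /=; case: ltngtP => // [ij|ji].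
  by have := last j; rewrite ij hj.
by have := later i ji; rewrite hi.
Qed.

Local Open Scope R_scope.

(** A union bound over later messages only, which are the pairs that the greedy choice controls. *)
Lemma last_hit_error_le (y : A) (j : 'I_M) :
  (if last_hit y == j then 0 else 1) <=
  (if hit j y then 0 else 1) +
  \big[Rplus/0]_(j' < M | (j < j')%nat) (if hit j' y then 1 else 0).
Proof.
have H0 (j' : 'I_M) : 0 <= if hit j' y then 1 else 0 by case: ifP; lra.
have : 0 <= \big[Rplus/0]_(j' < M | (j < j')%nat) (if hit j' y then 1 else 0).
  exact: rsum_ge0.
case: (boolP (last_hit y == j)) => [_|dj]; first by case: ifP; lra.
case: (boolP (hit j y)) => [hj _|_]; last by lra.
have [j' jj' hj'] := last_hit_neq dj hj.
suff : 1 <= \big[Rplus/0]_(j' < M | (j < j')%nat) (if hit j' y then 1 else 0) by lra.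
have := rsum_ge_term (P := fun j' : 'I_M => (j < j')%nat)
  (F := fun j' : 'I_M => if hit j' y then 1 else 0) jj' (fun j' _ => H0 j').
by rewrite hj'.
Qed.

End LastHitDecoder.

(** * Error probability of the combined code *)

Section ErrorAnalysis.
Local Open Scope R_scope.
Variables (X Y : finType) (S L m nB K : nat) (h : selector X Y S L m).
Variables (xx : codearr X S L m) (s0 : 'I_S) (P : 'I_S -> X -> R) (gamma : R).
Variables (encB : 'I_K -> {ffun 'I_nB -> X}).
Variables (phi : 'I_K -> selarr S L -> 'I_K) (psi : 'I_K -> 'I_K -> selarr S L).
Hypotheses (phiK : forall c, cancel (phi c) (psi c))
  (phi_inj : forall b, injective (phi^~ b)).
Variables (W1 W2 : X -> Y -> R).
Hypotheses (sW1 : stochastic W1) (sW2 : stochastic W2).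
Hypotheses (m_gt0 : (0 < m)%nat) (xxP : in_F P xx).

Notation n := (L * m + nB)%nat.
Notation sels := (selarr S L).
Notation blocks := {ffun 'I_L -> {ffun 'I_m -> Y}}.
Notation words n := {ffun 'I_n -> Y}.
Notation interleaver := {ffun 'I_L -> 'S_m}.
Notation outs := (outarr Y S L m).

Section OneReceiver.
Variables (k : 'I_2) (g : words nB -> 'I_K).
Let W := sel2 k W1 W2.

Lemma sel2_stochastic : stochastic W.
Proof. by rewrite /W /sel2; case: ifP. Qed.

Definition hits (p : interleaver) (c : 'I_K) (y : words n) : bool :=
  passes xx P W gamma (deint p (head_blocks y)) (psi c (g (tail_word y))).

Definition tail_error (i : 'I_K) : R :=
  \rsum_(w : words nB) (Wn W (encB i) w * (if g w == i then 0 else 1)).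

Lemma sum_tail_error : (0 < K)%nat ->
  \rsum_(i : 'I_K) tail_error i = INR K * FL_error W encB g.
Proof.
rewrite /FL_error => K_gt0.
have K1 : INR K <> 0 by apply: not_0_INR => K0; rewrite K0 in K_gt0.
rewrite big_distrr; apply: eq_bigr => i _; rewrite big_distrr; apply: eq_bigr => w _ /=.
by field.
Qed.

Lemma sum_code_prob (i : 'I_K) (F : words nB -> R) :
  \rsum_(w1 : words nB) \rsum_(w2 : words nB)
    (code_prob encB W1 W2 i w1 w2 * F (sel2 k w1 w2)) =
  \rsum_(w : words nB) (Wn W (encB i) w * F w).
Proof.
rewrite /code_prob /W /sel2; case: (k == ord0).
  apply: eq_bigr => w1 _; rewrite -[RHS]Rmult_1_r -(Wn_sum1 (encB i) sW2) big_distrr.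
  by apply: eq_bigr => w2 _ /=; ring.
rewrite exchange_big; apply: eq_bigr => w2 _.
rewrite -[RHS]Rmult_1_r -(Wn_sum1 (encB i) sW1) big_distrr.
by apply: eq_bigr => w1 _ /=; ring.
Qed.

(** A zero likelihood along the selected branches puts a zero factor in the array probability, so
    the outputs excluded from [info_L_le] carry no mass. *)
Lemma joint_eq0 (y1 y2 : outs) (b : sels) :
  block_prob xx W b (picked (sel2 k y1 y2) b) = 0 -> joint W1 W2 h xx y1 y2 b = 0.
Proof.
move=> blk0; rewrite (jointE h xx s0).
suff -> : array_prob xx W1 y1 * array_prob xx W2 y2 = 0 by rewrite Rmult_0_l.
have a0 : array_prob xx W (sel2 k y1 y2) = 0.
  have [//|nz] := Req_dec (array_prob xx W (sel2 k y1 y2)) 0; exfalso.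
  move: blk0; rewrite /block_prob; elim/big_ind: _ => [|u v u0 v0|l _]; first by lra.
    by case/Rmult_integral.
  rewrite ffunE; exact: rprod_neq0 (rprod_neq0 nz).
by move: a0; rewrite /W /sel2; case: (k == ord0) => ->; rewrite (Rmult_0_l, Rmult_0_r).
Qed.

Lemma sum_scheme_fails :
  \rsum_(z1 : blocks) \rsum_(z2 : blocks) (scheme_prob h xx s0 W1 W2 z1 z2 *
    (if passes xx P W gamma (sel2 k z1 z2) (bz h xx s0 z1 z2) then 0 else 1)) <=
  prob_info_le W1 W2 P h xx k gamma.
Proof.
rewrite -(sum_joint h xx s0 sW1 sW2
  (fun z1 z2 b => if passes xx P W gamma (sel2 k z1 z2) b then 0 else 1)).
apply: ler_rsum => y1 _; apply: ler_rsum => y2 _; apply: ler_rsum => b _.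
have pk : sel2 k (picked y1 b) (picked y2 b) = picked (sel2 k y1 y2) b.
  by rewrite /sel2; case: ifP.
have [/joint_eq0 ->|nz] := Req_dec (block_prob xx W b (picked (sel2 k y1 y2) b)) 0.
  by rewrite !Rmult_0_l; lra.
apply: Rmult_le_compat_l.
  rewrite (jointE h xx s0); apply: Rmult_le_pos; last by case: ifP; lra.
  by apply: Rmult_le_pos; apply: rprod_ge0 => l _; apply: rprod_ge0 => s _;
    exact: Wn_ge0.
rewrite pk; case: (boolP (passes _ _ _ _ _ _)) => [_|np].
  by case: Rle_dec => /= _; lra.
have := info_L_le m_gt0 xxP sel2_stochastic nz np => le.
by case: Rle_dec => /= H; [lra | case: H].
Qed.

(* A miss needs either a wrong relabelled selection or a failing threshold test
   at the true selection. *)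
Lemma miss_le p c :
  \rsum_(y1 : words n) \rsum_(y2 : words n)
    (msg_prob h xx s0 encB phi W1 W2 p c y1 y2 *
     (if hits p c (sel2 k y1 y2) then 0 else 1)) <=
  prob_info_le W1 W2 P h xx k gamma +
  \rsum_(z1 : blocks) \rsum_(z2 : blocks)
    (scheme_prob h xx s0 W1 W2 z1 z2 * tail_error (phi c (bz h xx s0 z1 z2))).
Proof.
pose F (z1 z2 : blocks) (w1 w2 : words nB) :=
  if passes xx P W gamma (sel2 k z1 z2) (psi c (g (sel2 k w1 w2))) then 0 else 1.
have -> : \rsum_(y1 : words n) \rsum_(y2 : words n)
    (msg_prob h xx s0 encB phi W1 W2 p c y1 y2 *
     (if hits p c (sel2 k y1 y2) then 0 else 1)) =
  \rsum_(y1 : words n) \rsum_(y2 : words n)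
    (msg_prob h xx s0 encB phi W1 W2 p c y1 y2 *
     F (deint p (head_blocks y1)) (deint p (head_blocks y2)) (tail_word y1) (tail_word y2)).
  apply: eq_bigr => y1 _; apply: eq_bigr => y2 _.
  by rewrite /F /hits /sel2; case: (k == ord0).
rewrite sum_msg_prob.
apply: Rle_trans (Rplus_le_compat_r _ _ _ sum_scheme_fails).
rewrite -big_split /=; apply: ler_rsum => z1 _.
rewrite -big_split /=; apply: ler_rsum => z2 _.
rewrite -Rmult_plus_distr_l; apply: Rmult_le_compat_l; first exact: scheme_prob_ge0.
set b := bz h xx s0 z1 z2; set i := phi c b.
rewrite /tail_error -sum_code_prob.
set t := if _ then 0 else 1.
(* Multiplying by the total mass 1 of the tail outputs reduces the claim to a pointwise comparison;
   when [g] is right, [phiK] recovers the true selection [b]. *)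
rewrite -[t]Rmult_1_r -[X in t * X](code_prob_sum1 encB sW1 sW2 i).
rewrite big_distrr -big_split /=; apply: ler_rsum => w1 _.
rewrite big_distrr -big_split /=; apply: ler_rsum => w2 _.
rewrite [t * _]Rmult_comm -Rmult_plus_distr_l; apply: Rmult_le_compat_l.
  by apply: Rmult_le_pos; exact: Wn_ge0.
rewrite /F /t; case: eqP => [->|_].
  by rewrite phiK Rplus_0_r; lra.
by case: ifP; case: ifP; lra.
Qed.

(** For fixed outputs the decoded selection does not involve [p'], so the average over interleavers
    is bounded pointwise and then integrated against a law of mass 1. *)
Lemma sum_hits_le p c c' :
  \rsum_(p' : interleaver) \rsum_(y1 : words n) \rsum_(y2 : words n)
    (msg_prob h xx s0 encB phi W1 W2 p c y1 y2 *
     (if hits p' c' (sel2 k y1 y2) then 1 else 0)) <=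
  INR #|{: interleaver}| * (exp (- gamma) * (1 + INR m) ^ (2 * L * #|X|)).
Proof.
set B := (X in _ <= X).
rewrite -[B]Rmult_1_r -[X in B * X](msg_prob_sum1 h xx s0 encB phi sW1 sW2 p c) big_distrr.
rewrite exchange_big /=; apply: ler_rsum => y1 _.
rewrite exchange_big big_distrr /=; apply: ler_rsum => y2 _.
rewrite -big_distrr /= [B * _]Rmult_comm; apply: Rmult_le_compat_l.
  exact: msg_prob_ge0.
rewrite /hits; exact: (sum_passes_deint gamma m_gt0 xxP sel2_stochastic).
Qed.

End OneReceiver.

Variables (y0 : Y) (q : nat) (g1 g2 : words nB -> 'I_K).
Hypotheses (K_gt0 : (0 < K)%nat) (q_gt0 : (0 < q)%nat).

(** Among [q * K] messages each residue occurs exactly [q] times. *)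
Definition label (j : nat) : 'I_K := Ordinal (ltn_pmod j K_gt0).

Definition encoder (C : nat -> interleaver) : FLF_enc X Y n (q * K) unit :=
  fun i _ j u1 u2 =>
    input h xx s0 encB phi (C j) (label j) (extend n y0 u1) (extend n y0 u2) i.

Lemma encoder_prefix C (i : 'I_n) u j (y1 y2 : words n) :
  encoder C u j (Defs.prefix i y1) (Defs.prefix i y2) =
  input h xx s0 encB phi (C j) (label j) y1 y2 i.
Proof.
by apply: input_causal => t ti; rewrite !(extend_prefix y0 _ ti).
Qed.

Lemma sum_label (F : 'I_K -> R) :
  \rsum_(j : 'I_(q * K)) F (label j) = INR q * \rsum_(c : 'I_K) F c.
Proof.
rewrite big_mul_ord -[X in INR X]card_ord -rsum_const.
apply: eq_bigr => l _; apply: eq_bigr => c _; congr F.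
by apply: val_inj; rewrite /= modnMDl modn_small.
Qed.

Definition first_msg : 'I_(q * K) := Ordinal (leq_mul q_gt0 K_gt0).

Definition confusion (k : 'I_2) (g : words nB -> 'I_K) (i j : nat)
  (p p' : interleaver) : R :=
  \rsum_(y1 : words n) \rsum_(y2 : words n)
    (msg_prob h xx s0 encB phi W1 W2 p (label i) y1 y2 *
     (if hits k g p' (label j) (sel2 k y1 y2) then 1 else 0)).

Lemma confusion_ge0 k g i j p p' : 0 <= confusion k g i j p p'.
Proof.
apply: rsum_ge0 => y1 _; apply: rsum_ge0 => y2 _; apply: Rmult_le_pos.
  exact: msg_prob_ge0.
by case: ifP; lra.
Qed.

Lemma code_error_le (C : nat -> interleaver) (k : 'I_2) (g : words nB -> 'I_K) :
  FLF_error W1 W2 (fun=> 1) (encoder C)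
    (last_hit first_msg (fun j => hits k g (C j) (label j))) k <=
  prob_info_le W1 W2 P h xx k gamma + FL_error (sel2 k W1 W2) encB g +
  / INR (q * K) *
    \rsum_(j : 'I_(q * K)) \rsum_(i : 'I_j) confusion k g i j (C i) (C j).
Proof.
set M := (q * K)%nat; set dec := last_hit _ _.
have M_gt0 : 0 < INR M by apply: lt_0_INR; apply/ltP; rewrite muln_gt0 q_gt0.
have Mi : 0 < / INR M by exact: Rinv_0_lt_compat.
pose msg j y1 y2 := msg_prob h xx s0 encB phi W1 W2 (C j) (label j) y1 y2.
have -> : FLF_error W1 W2 (fun=> 1) (encoder C) dec k =
  / INR M * \rsum_(j : 'I_M) \rsum_(y1 : words n) \rsum_(y2 : words n)
     (msg j y1 y2 * (if dec (sel2 k y1 y2) == j then 0 else 1)).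
  rewrite /FLF_error (big_pred1 tt) => [|[]//]; rewrite big_distrr.
  apply: eq_bigr => j _; rewrite big_distrr; apply: eq_bigr => y1 _.
  rewrite big_distrr; apply: eq_bigr => y2 _ /=.
  rewrite Rmult_1_l Rmult_assoc; congr (_ * (_ * _)).
  by apply: eq_bigr => i _; rewrite encoder_prefix.
have step (j : 'I_M) : \rsum_(y1 : words n) \rsum_(y2 : words n)
     (msg j y1 y2 * (if dec (sel2 k y1 y2) == j then 0 else 1)) <=
   (prob_info_le W1 W2 P h xx k gamma +
    \rsum_(z1 : blocks) \rsum_(z2 : blocks) (scheme_prob h xx s0 W1 W2 z1 z2 *
       tail_error k g (phi (label j) (bz h xx s0 z1 z2)))) +
   \big[Rplus/0]_(j' < M | (j < j')%nat) confusion k g j j' (C j) (C j').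
  apply: Rle_trans (Rplus_le_compat_r _ _ _ (miss_le k g (C j) (label j))).
  have -> : \big[Rplus/0]_(j' < M | (j < j')%nat) confusion k g j j' (C j) (C j') =
    \rsum_(y1 : words n) \rsum_(y2 : words n) (msg j y1 y2 *
      \big[Rplus/0]_(j' < M | (j < j')%nat)
         (if hits k g (C j') (label j') (sel2 k y1 y2) then 1 else 0)).
    rewrite exchange_big; apply: eq_bigr => y1 _.
    by rewrite exchange_big; apply: eq_bigr => y2 _; rewrite big_distrr.
  rewrite -big_split /=; apply: ler_rsum => y1 _.
  rewrite -big_split /=; apply: ler_rsum => y2 _.
  rewrite -Rmult_plus_distr_l; apply: Rmult_le_compat_l.
    exact: msg_prob_ge0.
  exact: (last_hit_error_le first_msg (fun j => hits k g (C j) (label j))).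
apply: Rle_trans (Rmult_le_compat_l _ _ _ (Rlt_le _ _ Mi)
  (ler_rsum _ (fun j _ => step j))) _.
rewrite !big_split /= rsum_const card_ord.
(* The pairs are regrouped by their later message, the form in which [greedy_choice] bounds them. *)
have -> : \rsum_(j : 'I_M) \big[Rplus/0]_(j' < M | (j < j')%nat)
     confusion k g j j' (C j) (C j') =
   \rsum_(j : 'I_M) \rsum_(i : 'I_j) confusion k g i j (C i) (C j).
  rewrite (exchange_big_dep xpredT) //=; apply: eq_bigr => j _.
  by rewrite (big_ord_widen M (fun i => confusion k g i j (C i) (C j)) (ltnW (ltn_ord j))).
(* The law of the selected blocks is common to all messages, so the sum over messages moves inside;
   for a fixed selection [phi_inj] turns it into [q] sums over all codewords. *)
have -> : \rsum_(j : 'I_M) \rsum_(z1 : blocks) \rsum_(z2 : blocks)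
    (scheme_prob h xx s0 W1 W2 z1 z2 *
     tail_error k g (phi (label j) (bz h xx s0 z1 z2))) =
    INR M * FL_error (sel2 k W1 W2) encB g.
  rewrite exchange_big -[RHS]Rmult_1_l -(scheme_prob_sum1 h xx s0 sW1 sW2).
  rewrite big_distrl; apply: eq_bigr => z1 _; rewrite exchange_big big_distrl.
  apply: eq_bigr => z2 _; rewrite -big_distrr; congr (_ * _).
  rewrite (sum_label (fun c => tail_error k g (phi c _))).
  rewrite -(reindex_inj (phi_inj (b := bz h xx s0 z1 z2)) (P := xpredT)
    (F := tail_error k g)) sum_tail_error //.
  by rewrite /M mult_INR; ring.
rewrite !Rmult_plus_distr_l -!Rmult_assoc Rinv_l; last by lra.
by rewrite !Rmult_1_l; exact: Rle_refl.
Qed.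

Lemma feedback_code_exists (e1 e2 tau : R) :
  (forall k, prob_info_le W1 W2 P h xx k gamma <= e1) ->
  FL_error W1 encB g1 <= e2 -> FL_error W2 encB g2 <= e2 ->
  INR (q * K) * (exp (- gamma) * (1 + INR m) ^ (2 * L * #|X|)) <= tau ->
  FLF_code_exists W1 W2 n (q * K) (e1 + tau + e2).
Proof.
set beta := exp _ * _ => e1P e21 e22 Mbeta.
set M := (q * K)%nat in Mbeta *.
have M_gt0n : (0 < M)%nat by rewrite muln_gt0 q_gt0.
have M_gt0 : 0 < INR M by apply: lt_0_INR; apply/ltP.
have beta0 : 0 <= beta.
  apply: Rmult_le_pos; first exact/Rlt_le/exp_pos.
  by apply: pow_le; have := pos_INR m; lra.
pose k2 : 'I_2 := lift ord0 ord0.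
(* Adding both receivers' costs makes one choice of interleavers serve both. The resulting
   [2 * beta] is offset by the half from counting each pair once. *)
pose conf i j p p' := confusion ord0 g1 i j p p' + confusion k2 g2 i j p p'.
have [||i j p|C CP] := @greedy_choice interleaver conf (2 * beta) _ _ _ M.
- by apply/card_gt0P; exists [ffun=> 1%g].
- by lra.
- rewrite /conf big_split /=.
  apply: Rle_trans (Rplus_le_compat _ _ _ _
    (sum_hits_le ord0 g1 p (label i) (label j))
    (sum_hits_le k2 g2 p (label i) (label j))) _.
  by rewrite -/beta -Rmult_plus_distr_l; apply: Req_le; congr Rmult; ring.
have conf_le (k : 'I_2) g :
    (forall i j p p', confusion k g i j p p' <= conf i j p p') ->
    / INR M * (\rsum_(j : 'I_M) \rsum_(i : 'I_j) confusion k g i j (C i) (C j)) <= tau.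
  move=> le.
  apply: Rle_trans (_ : / INR M * (INR M * INR M * (2 * beta) / 2) <= _).
    apply: Rmult_le_compat_l; first exact/Rlt_le/Rinv_0_lt_compat.
    by apply: Rle_trans CP; apply: ler_rsum => j _; apply: ler_rsum => i _.
  by apply: Rle_trans Mbeta; apply: Req_le; field; lra.
split=> //; exists unit, (fun=> 1), (encoder C),
  (last_hit first_msg (fun j => hits ord0 g1 (C j) (label j))),
  (last_hit first_msg (fun j => hits k2 g2 (C j) (label j))).
split; first split.
- by move=> u; lra.
- by rewrite rsum_const card_unit /=; lra.
split.
- apply: Rle_trans (code_error_le _ _ _) _; rewrite /= -/M.
  have := e1P ord0.
  have : / INR M * (\rsum_(j : 'I_M) \rsum_(i : 'I_j) confusion ord0 g1 i j (C i) (C j)) <= tau.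
    by apply: conf_le => i j p p'; have := confusion_ge0 k2 g2 i j p p'; rewrite /conf; lra.
  by move: e21; rewrite /sel2 /=; lra.
- apply: Rle_trans (code_error_le _ _ _) _; rewrite /= -/M.
  have := e1P k2.
  have : / INR M * (\rsum_(j : 'I_M) \rsum_(i : 'I_j) confusion k2 g2 i j (C i) (C j)) <= tau.
    by apply: conf_le => i j p p'; have := confusion_ge0 ord0 g1 i j p p'; rewrite /conf; lra.
  by move: e22; rewrite /sel2 /=; lra.
Qed.

End ErrorAnalysis.

(** * Trivial codes, integer rounding and the rate budget *)

Section Rate.
Local Open Scope R_scope.

Lemma single_message_code (X Y : finType) (W1 W2 : X -> Y -> R) (n : nat)
  (x0 : X) (e : R) : 0 <= e -> FLF_code_exists W1 W2 n 1 e.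
Proof.
move=> e0; split=> //.
exists unit, (fun=> 1), (fun _ _ _ _ _ => x0), (fun=> ord0), (fun=> ord0).
split; first split=> [u|]; first by lra.
  by rewrite rsum_const card_unit /=; lra.
by split; rewrite /FLF_error big1 // => u _; rewrite big1 // => j _;
  rewrite big1 // => y1 _; rewrite big1 // => y2 _; rewrite (ord1 j) eqxx Rmult_0_r.
Qed.

Lemma FL_error_ge0 (X Y : finType) (W : X -> Y -> R) (nB K : nat)
  (enc : 'I_K -> {ffun 'I_nB -> X}) (dec : {ffun 'I_nB -> Y} -> 'I_K) :
  stochastic W -> 0 <= FL_error W enc dec.
Proof.
move=> sW; apply: rsum_ge0 => j _; apply: rsum_ge0 => y _.
apply: Rmult_le_pos; last by case: ifP; lra.
apply: Rmult_le_pos; last exact: Wn_ge0.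
apply/Rlt_le/Rinv_0_lt_compat/lt_0_INR/ltP.
exact: leq_ltn_trans (ltn_ord j).
Qed.

(** An empty row would sum to 0 instead of 1. The letter found serves as padding for output
    prefixes. *)
Lemma stochastic_inhabited (X Y : finType) (W : X -> Y -> R) (x : X) :
  stochastic W -> exists y : Y, true.
Proof.
case=> _ /(_ x) W1; case: (pickP (@predT Y)) => [y _|Y0]; first by exists y.
by move: W1; rewrite big1 => [|y]; [lra | have := Y0 y].
Qed.

Lemma nat_ceil (v : R) : 0 < v -> exists2 q : nat, (0 < q)%nat & v <= INR q <= v + 1.
Proof.
move=> v0; have [up1 up2] := archimed v.
have up0 : (0 <= up v)%Z by apply: le_IZR; lra.
have E : INR (Z.to_nat (up v)) = IZR (up v) by rewrite INR_IZR_INZ Znat.Z2Nat.id.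
exists (Z.to_nat (up v)); last by rewrite E; lra.
by apply/ltP; apply: INR_lt; rewrite E /=; lra.
Qed.

Lemma pow_expn (a b : nat) : Nat.pow a b = expn a b.
Proof. by elim: b => //= b ->; rewrite expnS. Qed.

Lemma exp_mul_ln (n : nat) (a : R) : 0 < a -> exp (INR n * ln a) = a ^ n.
Proof. by move=> a0; rewrite -pow_exp exp_ln. Qed.

(* For a positive rate, rounding [exp r] up to a multiple of [K] costs at most
   the factor [2 * K], which the terms [ln 2] and [L ln S] of the rate pay for. *)
Lemma rate_budget (gamma tau zeta : R) (S L m N N' q : nat) :
  let r := gamma + ln (tau / 2) - INR N * ln (1 + INR m) - INR L * ln (INR S) - zeta in
  0 < tau -> 0 < zeta -> (0 < S)%nat -> (N' <= N)%nat -> 0 <= r ->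
  INR q <= exp r / INR (Nat.pow S L) + 1 ->
  INR (q * Nat.pow S L) * (exp (- gamma) * (1 + INR m) ^ N') <= tau.
Proof.
move=> r tau0 zeta0 S0 NN' r0 q_le.
have S1 : 0 < INR S by apply: lt_0_INR; apply/ltP.
have m0 := pos_INR m.
set K := Nat.pow S L in q_le *.
have KE : INR K = INR S ^ L by rewrite /K pow_INR.
have K1 : 1 <= INR K.
  by apply: (le_INR 1); apply/leP; rewrite /K pow_expn expn_gt0 S0.
(* This is the definition of [r], exponentiated. *)
have E : exp r * (1 + INR m) ^ N * INR K * exp zeta = exp gamma * (tau / 2).
  rewrite KE -!exp_mul_ln //; last by lra.
  rewrite -[X in _ = _ * X]exp_ln; last by lra.
  by rewrite -!exp_plus; congr exp; rewrite /r; ring.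
have er1 : 1 <= exp r by have := exp_ineq1_le r; lra.
have z1 : 1 <= exp zeta by have := exp_ineq1_le zeta; lra.
have eg := exp_pos (- gamma).
have A0 : 0 < (1 + INR m) ^ N' by apply: pow_lt; lra.
have A1 : (1 + INR m) ^ N' <= (1 + INR m) ^ N.
  by apply: Rle_pow; [lra | apply/leP].
(* The product is at most [exp r + INR K], and both terms are at least 1. *)
have M_le : INR (q * K) <= 2 * (exp r * INR K).
  rewrite mult_INR; apply: Rle_trans (_ : (exp r / INR K + 1) * INR K <= _).
    by apply: Rmult_le_compat_r; lra.
  have -> : (exp r / INR K + 1) * INR K = exp r + INR K by field; lra.
  by nra.
apply: Rle_trans (_ : 2 * (exp r * INR K) * (exp (- gamma) * (1 + INR m) ^ N) <= _).
  apply: Rmult_le_compat => //; first exact: pos_INR.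
    by apply: Rmult_le_pos; lra.
  by apply: Rmult_le_compat_l; lra.
set A := (1 + INR m) ^ N in A1 E *.
have EA : 0 <= exp r * A * INR K.
  by apply: Rmult_le_pos; [apply: Rmult_le_pos | ]; lra.
have le1 : exp r * A * INR K <= exp gamma * (tau / 2) by rewrite -E; nra.
have ee : exp (- gamma) * exp gamma = 1 by rewrite -exp_plus Rplus_opp_l exp_0.
have := Rmult_le_compat_l _ _ _ (Rlt_le _ _ eg) le1.
by rewrite -[X in _ <= X]Rmult_assoc ee; lra.
Qed.

End Rate.

(** * Choice of the number of messages and conclusion *)

Theorem theorem2 (X Y : finType) (W1 W2 : X -> Y -> R) (S L m nB : nat)
  (P : 'I_S -> X -> R) (eps tau zeta : R) (h : selector X Y S L m)
  (xx : codearr X S L m) (epsB : R) :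
  stochastic W1 -> stochastic W2 ->
  (2 <= S)%N -> (0 < L)%N -> (0 < m)%N -> (0 < nB)%N ->
  (forall s, is_type m (P s)) ->
  (0 < eps < 1)%R -> (0 < tau < eps)%R -> (0 < zeta)%R ->
  in_F P xx ->
  is_epsstar W1 W2 nB (S ^ L) epsB ->
  forall gamma : R,
    (forall k : 'I_2, prob_info_le W1 W2 P h xx k gamma < eps - tau - exp (- zeta))%R ->
    log_Mstar_ge W1 W2 (L * m + nB) (eps + epsB)
      (gamma + ln (tau / 2) - INR (S * L * #|X|) * ln (1 + INR m)
       - INR L * ln (INR S) - zeta)%R.
Proof.
move=> sW1 sW2 S2 L0 m0 _ _ eps01 tau_eps zeta0 xxP [[encB [g1 [g2 [e1 e2]]]] _].
move=> gamma p_lt; set r := (_ - zeta)%R.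
have s0 : 'I_S := Ordinal (ltnW S2).
have x0 : X := xx (Ordinal L0) s0 (Ordinal m0).
have [y0 _] := stochastic_inhabited x0 sW1.
have epsB0 : (0 <= epsB)%R := Rle_trans _ _ _ (FL_error_ge0 encB g1 sW1) e1.
(* A single message achieves any nonpositive rate; a positive one gives [exp r >= 1], which the
   rounding estimate uses. *)
case: (Rle_dec r 0) => [r_le0|/Rnot_le_lt r_gt0].
  exists 1; split; last by rewrite ln_1.
  by apply: single_message_code; [exact: x0 | lra].
have K0 : 0 < Nat.pow S L by rewrite pow_expn expn_gt0 (ltnW S2).
have K1 : (0 < INR (Nat.pow S L))%R by apply: lt_0_INR; apply/ltP.
have cardK : #|{: selarr S L}| = Nat.pow S L by rewrite card_ffun !card_ord pow_expn.
have [phi [psi [phiK phi_inj]]] := cyclic_relabelling cardK K0.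
have [|q q0 [q_ge q_le]] := @nat_ceil (exp r / INR (Nat.pow S L)).
  by apply: Rdiv_lt_0_compat; first exact: exp_pos.
exists (q * Nat.pow S L); split; last first.
  have M_ge : (exp r <= INR (q * Nat.pow S L))%R.
    have := Rmult_le_compat_r _ _ _ (Rlt_le _ _ K1) q_ge.
    by rewrite mult_INR (_ : (_ / _ * _ = exp r)%R) //; field; lra.
  apply: Rnot_lt_le => /exp_increasing lt; have er := exp_pos r.
  by rewrite exp_ln in lt; lra.
(* The error budget: [eps - tau] for failing tests, [tau] for confusions, [epsB] for the tail
   code. *)
have -> : (eps + epsB = (eps - tau) + tau + epsB)%R by ring.
apply: (feedback_code_exists (h := h) s0 (gamma := gamma) phiK phi_inj sW1 sW2 m0 xxP
  y0 K0 q0 _ e1 e2).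
  by move=> k; have := p_lt k; have := exp_pos (- zeta); lra.
apply: (rate_budget (zeta := zeta) (N := (S * L * #|X|)%nat)) => //; first by lra.
- exact: ltnW.
(* The exponent [2 * L * #|X|] from the interleaver average fits into [S * L * #|X|] since
   [2 <= S]. *)
- by rewrite -!mulnA leq_mul2r S2 orbT.
- exact: Rlt_le.
Qed.
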